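(* If $G$ is a planar graph with $g(G)\geq 8$ and $\Delta(G)\geq 4$, then $\chi^2_l(G)\leq \Delta(G)+3$.
   Context: All graphs are finite, simple and undirected. $\Delta(G)$ is the maximum degree of $G$, and $g(G)$ is the girth of $G$, i.e. the length of a shortest cycle (taken to be $+\infty$ if $G$ has no cycle). A 2-distance coloring of $G$ is a map on $V(G)$ assigning different colors to any two distinct vertices at distance at most 2. The 2-distance list chromatic number $\chi^2_l(G)$ is the smallest integer $k$ such that for every list assignment $L=\{L(v): v\in V(G)\}$ with $|L(v)|\geq k$ for all $v\in V(G)$, there is a 2-distance coloring $\phi$ of $G$ with $\phi(v)\in L(v)$ for all $v\in V(G)$. *)

(* Defs.v *)
From HB Require Import structures.
From mathcomp Require Import all_boot all_order all_algebra.
From mathcomp Require Import all_classical all_reals all_analysis.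

Set Implicit Arguments.
Unset Strict Implicit.
Unset Printing Implicit Defensive.

Import Order.TTheory GRing.Theory Num.Theory.
Import numFieldNormedType.Exports.

Local Open Scope classical_set_scope.
Local Open Scope ring_scope.

Record sgraph := SGraph {
  vertex :> finType;
  adj : rel vertex;
  adj_sym : symmetric adj;
  adj_irr : irreflexive adj
}.
Arguments adj : clear implicits.

Definition degree (G : sgraph) (v : G) : nat := #|[pred w | adj G v w]|.

Definition max_degree (G : sgraph) : nat := \max_(v : G) degree v.

(* The closed walk x0 x1 ... xk x0 is the sequence [:: x0; ...; xk]; its length
   is the size of the sequence. The bound on the size excludes the sequences
   [::] and [:: x; y], which satisfy ucycle without being cycles. *)
Definition is_cycle (G : sgraph) (c : seq G) : Prop :=
  ucycle (adj G) c /\ (3 <= size c)%N.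

(* The infimum of the empty set is +oo; a nonempty set of lengths has a least
   element, so the infimum is then attained. *)
Definition girth (R : realType) (G : sgraph) : \bar R :=
  ereal_inf [set ((size c)%:R)%:E | c in [set c : seq G | is_cycle c]].

(* dist_le k u v: the distance between u and v is at most k, that is, some walk
   from u to v has at most k edges. *)
Definition dist_le (G : sgraph) (k : nat) (u v : G) : Prop :=
  exists p : seq G, [/\ path (adj G) u p, last u p = v & (size p <= k)%N].

Definition is_2dist_coloring (G : sgraph) (C : eqType) (phi : G -> C) : Prop :=
  forall u v : G, u != v -> dist_le 2 u v -> phi u != phi v.

(* The set C of colours is arbitrary. Taking it finite loses nothing: an
   infinite list may be replaced by one of its k-element subsets. *)
Definition choosable_2dist (G : sgraph) (k : nat) : Prop :=
  forall (C : finType) (L : G -> {set C}),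
    (forall v, (k <= #|L v|)%N) ->
    exists phi : G -> C, is_2dist_coloring phi /\ forall v, phi v \in L v.

Lemma distinct_representatives (V C : finType) (L : V -> {set C}) (c0 : C)
    (s : seq V) :
  (forall v, (size s <= #|L v|)%N) -> uniq s ->
  exists f : V -> C, {in s &, injective f} /\ {in s, forall v, f v \in L v}.
Proof.
elim: s => [|x s IHs] /= sL; first by exists (fun=> c0).
case/andP=> xs us.
have [|f [finj fL]] := IHs _ us; first by move=> v; exact: ltnW (sL v).
have [c cL cfs] : exists2 c, c \in L x & c \notin map f s.
  have /fintype.subsetPn[c cL cN] : ~~ (L x \subset map f s).
    apply/negP => /subset_leq_card le1.
    have := leq_trans (sL x) (leq_trans le1 (card_size _)).
    by rewrite size_map ltnn.
  by exists c.
have fE v : v \in s -> (if v == x then c else f v) = f v.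
  by move=> vs; case: eqP => // vx; rewrite -vx vs in xs.
exists (fun v => if v == x then c else f v); split.
- move=> u v; rewrite !inE; case: (eqVneq u x) => [->|ux] /=;
    case: (eqVneq v x) => [->|vx] //=.
  + by move=> _ vs cE; rewrite cE map_f in cfs.
  + by move=> us' _ cE; rewrite -cE map_f in cfs.
  + exact: finj.
- by move=> v; rewrite inE; case: (eqVneq v x) => [->|_] //= /fL.
Qed.

Lemma ex_choosable_2dist (G : sgraph) :
  exists k, (fun k => `[< choosable_2dist G k >]) k.
Proof.
exists #|G|; apply/asboolP => C L cL.
have [v0|G0] := pickP (fun _ : G => true); last first.
  have noG (v : G) : False by have := G0 v.
  by exists (fun v => False_rect C (noG v)); split=> v; case: (noG v).
move=> _.
have /card_gt0P[c0 _] : (0 < #|L v0|)%N.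
  by apply: leq_trans (cL v0); apply/card_gt0P; exists v0.
have [|f [finj fL]] := distinct_representatives c0 _ (enum_uniq G) (L := L).
  by move=> v; rewrite -cardE.
exists f; split=> [u v uv _|v]; last by apply: fL; rewrite mem_enum.
by apply: contra_neq uv; apply: finj; rewrite mem_enum.
Qed.

Definition chi2l (G : sgraph) : nat := ex_minn (ex_choosable_2dist G).

(* A drawing of G in the plane R^2 without crossings: vertices are distinct
   points, the edge uv is a simple arc gam u v, parametrized by [0, 1], from u
   to v, and the interior of an edge meets no vertex and no other edge.
   gam u v is irrelevant when u and v are not adjacent. *)
Definition plane_drawing (R : realType) (G : sgraph)
    (pt : G -> R * R) (gam : G -> G -> R -> R * R) : Prop :=
  [/\ injective pt,
      forall u v, adj G u v ->
        [/\ {within `[0, 1], continuous (gam u v)},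
            {in `[0, 1] &, injective (gam u v)},
            gam u v 0 = pt u, gam u v 1 = pt v &
            forall t, t \in `[0, 1] -> gam v u t = gam u v (1 - t)],
      forall u v w t, adj G u v -> t \in `]0, 1[ -> gam u v t <> pt w &
      forall u v x y s t, adj G u v -> adj G x y ->
        (x, y) != (u, v) -> (x, y) != (v, u) ->
        s \in `]0, 1[ -> t \in `]0, 1[ -> gam u v s <> gam x y t].

Definition planar (R : realType) (G : sgraph) : Prop :=
  exists (pt : G -> R * R) (gam : G -> G -> R -> R * R), plane_drawing pt gam.

(* Main.v *)
Require Import Defs.
From mathcomp Require Import all_boot all_order all_algebra.
From mathcomp Require Import ring lra zify.

(* A minimal uncolourable induced subgraph has no small reducible configuration,
   and a discharging argument then gives it average degree at least 8/3: every
   vertex of degree at least 4 gives 1/3 to each neighbour, and every vertex of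
   degree 3 gives 1/3 to each neighbour of degree 2 and to each neighbour of
   degree 3 having itself two neighbours of degree 2.

   A planar graph of girth at least 8 has average degree less than 8/3. Every
   drawing is approximated on a fine square lattice: each vertex becomes a
   square, and each edge a lattice walk, these being disjoint outside the
   squares. The parity of the number of crossings with a vertical ray splits
   the lattice cells into faces, and modulo 2 the even edge sets are exactly the
   boundaries of sets of faces. There are at least 2^(E-V+1) even edge sets, so
   at least E-V+1 faces have a nonempty boundary; each such boundary contains a
   cycle, hence has at least 8 edges, and each edge lies on at most two of them:
   8(E-V+1) <= 2E. *)

Set Implicit Arguments.
Unset Strict Implicit.
Unset Printing Implicit Defensive.

(** Euler's formula for a drawing would require the Jordan curve theorem. Only E - V + 1 <= F is
    needed, and it follows from two statements modulo 2: each face has an even boundary, and each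
    even set bounds a set of faces. On a lattice both reduce to local computations with rays.
    Squares surround the vertices because arcs with a common end come arbitrarily close there;
    outside the squares, compactness keeps distinct arcs a positive distance apart.

    In the colouring half, k stays the maximum degree of the whole graph while the induced subgraph
    shrinks. Distances are measured inside the subgraph, so a deletion may destroy conflicts; this
    is why a deleted vertex may keep at most one remaining neighbour.

    The constant 8/3 comes from 8(E-V+1) <= 2E, that is 6E < 8V. With initial charge d - 8/3 a
    vertex of degree 2 lacks 2/3, one third from each neighbour, and degree 4 is the least d for
    which d - 8/3 >= d/3. *)

Lemma addb_sum_odd (I : finType) (P b : pred I) :
  \big[addb/false]_(i | P i) b i = odd #|[set i | P i && b i]|.
Proof.
rewrite -sum1dep_card big_mkcondr /=.
by elim/big_rec2: _ => // i m c _ ->; rewrite oddD; case: (b i).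
Qed.

(** * Even edge sets and an Euler-type inequality *)

Section EvenSets.
Variables (V E : finType) (s t : E -> V).
Implicit Types (z : {set E}) (v : V).

Definition inc (e : E) (v : V) : bool := (s e == v) (+) (t e == v).

Definition bdry z v : bool := \big[addb/false]_(e in z) inc e v.

Definition even_set z : bool := [forall v, ~~ bdry z v].

Definition symdiff z1 z2 : {set E} := [set e | (e \in z1) (+) (e \in z2)].

Lemma bdry_symdiff z1 z2 v : bdry (symdiff z1 z2) v = bdry z1 v (+) bdry z2 v.
Proof.
rewrite /bdry !(big_mkcond (fun e => e \in _)) /= -big_split /=.
by apply: eq_bigr => e _; rewrite inE; do 2!case: (e \in _); case: (inc e v).
Qed.

Lemma symdiffK z : cancel (symdiff z) (symdiff z).
Proof. by move=> z'; apply/setP=> e; rewrite !inE addbA addbb. Qed.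

Lemma sum_bdry z : \big[addb/false]_v bdry z v = false.
Proof.
rewrite /bdry exchange_big /= big1 // => e _.
have sum1 (x : V) : \big[addb/false]_v (x == v) = true.
  by rewrite (bigD1 x) //= eqxx big1 // => v /negPf; rewrite eq_sym.
by rewrite /inc big_split /= !sum1.
Qed.

(** Rank-nullity for the boundary map over the two-element field: its kernel consists of the even
    sets, and a boundary lives on [A] with total parity 0, so its entries off [v0] determine it. *)
Lemma card_even_sets (A : {set V}) (v0 : V) :
  (forall e, s e \in A) -> (forall e, t e \in A) -> v0 \in A ->
  2 ^ #|E| <= #|[set z | even_set z]| * 2 ^ #|A|.-1.
Proof.
move=> sA tA Av0.
have bdryA z v : v \notin A -> bdry z v = false.
  move=> vA; rewrite /bdry big1 // => e _; rewrite /inc.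
  have -> : (s e == v) = false by apply: contraNF vA => /eqP <-.
  by have -> : (t e == v) = false by apply: contraNF vA => /eqP <-.
pose bd z := [set v | (v != v0) && bdry z v].
(* A chosen member of the fibre of [bd] through [z]; the symmetric difference with it sends [z] into
   the kernel. *)
pose rep z := odflt z [pick z' | bd z' == bd z].
have bd_rep z : bd (rep z) = bd z.
  by rewrite /rep; case: pickP => [z' /eqP|] //.
have rep_eq z1 z2 : bd z1 = bd z2 -> rep z1 = rep z2.
  move=> e12; rewrite /rep e12; case: pickP => // /(_ z2).
  by rewrite eqxx.
pose f z := (symdiff (rep z) z, bd z).
have f_inj : injective f.
  move=> z1 z2 [e1 e2]; rewrite (rep_eq _ _ e2) in e1.
  by rewrite -[z1](symdiffK (rep z2)) e1 symdiffK.
have <- : #|{set E}| = 2 ^ #|E| by rewrite -[LHS]cardsT -powersetT card_powerset cardsT.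
have <- : #|powerset (A :\ v0)| = 2 ^ #|A|.-1.
  by rewrite card_powerset (cardsD1 v0 A) Av0.
rewrite -cardsX -cardsT -(card_imset _ f_inj).
apply/subset_leq_card/subsetP => _ /imsetP[z _ ->].
rewrite !inE; apply/andP; split; last first.
  apply/subsetP=> v; rewrite !inE => /andP[-> vz] /=.
  by apply: contraLR vz => /bdryA->.
have off v : v != v0 -> bdry (symdiff (rep z) z) v = false.
  move=> vv0; have /setP/(_ v) := bd_rep z.
  by rewrite !inE vv0 /= bdry_symdiff => ->; rewrite addbb.
apply/forallP=> v; have [->|/off-> //] := eqVneq v v0.
(* The entry at [v0] is forced by the total parity. *)
have := sum_bdry (symdiff (rep z) z).
rewrite (bigD1 v0) //= big1 => [|w /off //]; by rewrite addbF => ->.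
Qed.

End EvenSets.

Section EulerBound.
Variables (V E F : finType) (s t : E -> V) (l r : E -> F).

Definition face_bdry (phi : {set F}) : {set E} :=
  [set e | (l e \in phi) (+) (r e \in phi)].

(** A face with empty boundary lies on both sides or on neither side of each edge, so removing it
    from [phi] does not change the boundary of [phi]. *)
Lemma card_even_sets_faces :
  (forall z : {set E}, even_set s t z -> exists phi : {set F}, z = face_bdry phi) ->
  #|[set z | even_set s t z]| <= 2 ^ #|[set f | face_bdry [set f] != set0]|.
Proof.
move=> face_cover; set F' := [set f | face_bdry _ != _].
have := leq_imset_card face_bdry (powerset F'); rewrite card_powerset; apply: leq_trans.
apply/subset_leq_card/subsetP=> z; rewrite inE => /face_cover[phi ->].
apply/imsetP; exists (phi :&: F'); first by rewrite inE subsetIr.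
apply/setP=> e; rewrite !inE.
have [->|lr] := eqVneq (l e) (r e); first by rewrite !addbb.
have -> : face_bdry [set l e] != set0.
  by apply/set0Pn; exists e; rewrite !inE eqxx eq_sym (negPf lr).
have -> : face_bdry [set r e] != set0.
  by apply/set0Pn; exists e; rewrite !inE eqxx (negPf lr).
by rewrite !andbT.
Qed.

Lemma euler_bound (A : {set V}) (v0 : V) (g : nat) :
  (forall e, s e \in A) -> (forall e, t e \in A) -> v0 \in A ->
  (forall f, even_set s t (face_bdry [set f])) ->
  (forall z : {set E}, even_set s t z -> exists phi : {set F}, z = face_bdry phi) ->
  (forall z, even_set s t z -> z != set0 -> g <= #|z|) ->
  g * #|E|.+1 <= 2 * #|E| + g * #|A|.
Proof.
move=> sA tA Av0 face_even face_cover long.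
set F' := [set f | face_bdry [set f] != set0].
have EVF : #|E| <= #|F'| + #|A|.-1.
  rewrite -(@leq_exp2l 2) // expnD.
  apply: leq_trans (card_even_sets sA tA Av0) _.
  by rewrite leq_mul2r card_even_sets_faces // orbT.
have gF : g * #|F'| <= 2 * #|E|.
  have le1 : g * #|F'| <= \sum_f #|face_bdry [set f]|.
    rewrite mulnC -sum_nat_const big_mkcond leq_sum // => f _.
    by rewrite inE; case: ifP => // /long->.
  apply: leq_trans le1 _.
  under eq_bigr do rewrite -sum1_card big_mkcond.
  rewrite exchange_big /= mulnC -sum_nat_const leq_sum // => e _.
  rewrite -big_mkcond /= sum1_card.
  (* Only the two faces at [e] can have [e] on their boundary. *)
  apply: leq_trans (_ : #|[set l e; r e]| <= 2); last by rewrite cards2; case: (_ != _).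
  apply/subset_leq_card/subsetP=> f fe; have: e \in face_bdry [set f] by [].
  rewrite !inE [l e == f]eq_sym [r e == f]eq_sym.
  by case: (f == l e) => //=; case: (f == r e).
have A0 : 0 < #|A| by apply/card_gt0P; exists v0.
by rewrite -(prednK A0) in EVF *; nia.
Qed.

End EulerBound.

(** A path is prolonged at its head [x]. It cannot outgrow [V], so eventually a second neighbour of
    the head already lies on the path and closes a cycle. *)
Lemma cycle_of_min_degree2 (V : finType) (d : rel V) (x y : V) :
  symmetric d -> irreflexive d ->
  (forall v w, d v w -> exists2 w', d v w' & w' != w) ->
  d x y -> exists c, ucycle d c /\ 3 <= size c.
Proof.
move=> dC d0 d2 xy.
have: exists x p, [/\ path d x p, uniq (x :: p) & 0 < size p].
  exists x, [:: y]; rewrite /= xy inE; split=> //.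
  by rewrite andbT; apply: contraTneq xy => ->; rewrite d0.
case=> {x y xy} x [p []]; have [n] := ubnP (#|V| - size p).
elim: n => // n IHn in x p *; case: p => // y p lt_n xp Uxp _.
have [w xw wy] : exists2 w, d x w & w != y by apply: d2; case/andP: xp.
have wx : w != x by apply: contraTneq xw => ->; rewrite d0.
have [wp|wp] := boolP (w \in p); last first.
  apply: (IHn w (x :: y :: p)); rewrite /= ?(dC w) ?xw //; last first.
    by rewrite !inE (negPf wx) (negPf wy) (negPf wp).
  have := max_card (mem [:: w, x, y & p]).
  rewrite (card_uniqP _) /= ?inE; last by rewrite (negPf wx) (negPf wy) (negPf wp).
  by move: lt_n => /=; lia.
case/splitPr: wp => p1 p2 in xp Uxp {lt_n}.
exists (x :: y :: rcons p1 w); split; last by rewrite /= size_rcons.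
move: xp Uxp; rewrite -cat_rcons /ucycle /= => /andP[xy].
rewrite cat_path rcons_path last_rcons => /andP[yp1 _].
rewrite !rcons_path !last_rcons xy yp1 (dC w) xw !inE !mem_cat /=.
by rewrite cat_uniq !negb_or => /and3P[/and3P[-> -> _] /andP[-> _] /andP[-> _]].
Qed.

Section LongEvenSets.
Variables (V E : finType) (adj : rel V) (s t : E -> V).
Hypothesis adjC : symmetric adj.
Hypothesis adj0 : irreflexive adj.
Hypothesis adj_edge : forall e, adj (s e) (t e).
Hypothesis edge_inj : forall e e',
  s e = s e' /\ t e = t e' \/ s e = t e' /\ t e = s e' -> e = e'.

(** The graph formed by [z] has no vertex of degree 1, hence contains a cycle [c]. Its edges need
    not be extracted: each vertex of [c] meets at least two edges of [z] and each edge has two ends,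
    so [2 * size c <= 2 * #|z|]. *)
Lemma even_set_long (g : nat) (z : {set E}) :
  (forall c, ucycle adj c -> 3 <= size c -> g <= size c) ->
  even_set s t z -> z != set0 -> g <= #|z|.
Proof.
move=> girth_g /forallP even_z z0.
have st e : s e != t e by apply: contraTneq (adj_edge e) => ->; rewrite adj0.
pose inz (v : V) := [set e in z | inc s t e v].
have deg2 v e : e \in inz v -> exists2 e', e' \in inz v & e' != e.
  move=> ev; have := even_z v; rewrite /bdry addb_sum_odd -/(inz v).
  rewrite (cardsD1 e) ev /= negbK => odd1.
  have /card_gt0P[e'] : 0 < #|inz v :\ e| by case: #|_| odd1.
  by rewrite in_setD1 => /andP[ne inz']; exists e'.
pose d u w := [exists e in z, (s e == u) && (t e == w) || (s e == w) && (t e == u)].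
have dP u w : reflect (exists2 e, e \in z & (s e = u /\ t e = w) \/ (s e = w /\ t e = u)) (d u w).
  apply: (iffP exists_inP) => -[e ez H]; exists e => //.
    by case/orP: H => /andP[/eqP-> /eqP->]; [left | right].
  by case: H => -[-> ->]; rewrite !eqxx ?orbT.
have dC : symmetric d.
  by move=> u w; apply/dP/dP=> -[e ez H]; exists e => //; case: H => H; auto.
have d_adj : subrel d adj.
  by move=> u w /dP[e _ [] [<- <-]]; rewrite // adjC.
have d_inz u w : d u w -> exists2 e, e \in inz u & (s e = u /\ t e = w) \/ (s e = w /\ t e = u).
  case/dP=> e ez H; exists e => //; rewrite inE ez /inc.
  by have := st e; case: H => -[-> ->]; rewrite eqxx => /negPf; rewrite ?[w == u]eq_sym => ->.
have [x [y xy]] : exists x y, d x y.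
  by case/set0Pn: z0 => e ez; exists (s e), (t e); apply/dP; exists e => //; left.
have d0 : irreflexive d.
  by move=> u; have := d_adj u u; rewrite adj0; case: (d u u) => // /(_ isT).
(* Evenness gives a second edge at [v]; without parallel edges it leads to another neighbour. *)
have dd2 v w : d v w -> exists2 w', d v w' & w' != w.
  case/d_inz=> e /deg2[e']; rewrite inE => /andP[ez'].
  have := st e'; rewrite /inc.
  have [sv|nsv] := eqVneq (s e') v; have [tv|ntv] := eqVneq (t e') v => //=.
  - move=> _ _ ne H; exists (t e'); first by apply/dP; exists e' => //; left.
    apply: contraNneq ne => tw; apply/eqP/edge_inj.
    by case: H => -[-> ->]; [left | right].
  - move=> _ _ ne H; exists (s e'); first by apply/dP; exists e' => //; right.
    apply: contraNneq ne => tw; apply/eqP/edge_inj.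
    by case: H => -[-> ->]; [right | left].
have [c [/andP[cyc Uc] c3]] := cycle_of_min_degree2 dC d0 dd2 xy.
have cyca : cycle adj c by apply: sub_cycle cyc.
apply: leq_trans (girth_g c _ c3) _; first by rewrite /ucycle cyca.
have c_inz v : v \in c -> 2 <= #|inz v|.
  move=> vc; have /d_inz[e ev _] := next_cycle cyc vc.
  have [e' ev' ne] := deg2 _ _ ev.
  by rewrite (cardsD1 e) ev (cardsD1 e') in_setD1 ne ev'.
have : \sum_v #|inz v| <= 2 * #|z|.
  under eq_bigr do rewrite -sum1_card big_mkcond.
  rewrite exchange_big /= mulnC -sum_nat_const [leqRHS]big_mkcond leq_sum // => e _.
  case: ifP => ez; last by rewrite big1 // => v _; rewrite inE ez.
  rewrite -big_mkcond /= sum1_card.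
  apply: leq_trans (_ : #|[set s e; t e]| <= 2); last by rewrite cards2; case: (_ != _).
  apply/subset_leq_card/subsetP=> v vb; have: e \in inz v by []; rewrite !inE ez /inc -!(eq_sym v) /=.
  by case: (v == s e) => //=; case: (v == t e).
move=> le1; rewrite -(@leq_pmul2l 2) //; apply: leq_trans le1.
rewrite -(card_uniqP Uc) mulnC -sum_nat_const big_mkcond leq_sum // => v _.
by case: ifP => // /c_inz.
Qed.

End LongEvenSets.

(** * Reducible configurations *)

Ltac solve_neqs :=
  repeat (apply/andP; split); solve [assumption | rewrite eq_sym; assumption].

Section ListColours.
Variable C : finType.
Implicit Types (X Y U : {set C}) (a b c : C).

Lemma pick_avoiding X (s : seq C) : size s < #|X| -> exists2 c, c \in X & c \notin s.
Proof.
move=> lt_sX; have /subsetPn[c cX cs] : ~~ (X \subset s).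
  apply/negP => /subset_leq_card le1.
  by have := leq_trans lt_sX (leq_trans le1 (card_size _)); rewrite ltnn.
by exists c.
Qed.

Lemma pick_outside X U : #|U| < #|X| -> exists2 c, c \in X & c \notin U.
Proof.
rewrite cardE => /pick_avoiding[c cX]; rewrite mem_enum => cU; by exists c.
Qed.

Lemma subset_of_card X n : n <= #|X| -> exists2 Y : {set C}, Y \subset X & #|Y| = n.
Proof.
move=> nX; exists [set x in take n (enum X)].
  by apply/subsetP=> x; rewrite inE => /mem_take; rewrite mem_enum.
have /card_uniqP sz : uniq (take n (enum X)) by rewrite take_uniq ?enum_uniq.
rewrite cardsE sz size_take -cardE.
by case: ltngtP nX.
Qed.

(** Two leaves must avoid each other and the fixed colours [a] and [b]; the leaf coloured last faces
    three forbidden colours, one too many. A fixed colour missing from [U] forbids nothing there. *)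
Lemma colour_pair X U Y a b : U \subset X -> 3 <= #|U| -> 3 <= #|Y| ->
  a \notin U \/ b \notin U ->
  exists c1 c2, [/\ c1 \in X, c2 \in Y &
    [&& c1 != c2, c1 != a, c1 != b, c2 != a & c2 != b]].
Proof.
move=> /subsetP UX U3 Y3 abU.
have [c2 c2Y] : exists2 c2, c2 \in Y & c2 \notin [:: a; b] by apply: pick_avoiding.
rewrite !inE negb_or => /andP[n2a n2b].
have [c1 c1U /and3P[n12 n1a n1b]] :
    exists2 c1, c1 \in U & [&& c1 != c2, c1 != a & c1 != b].
  case: abU => [aU|bU].
    have [c1 c1U] : exists2 c, c \in U & c \notin [:: c2; b] by apply: pick_avoiding.
    rewrite !inE negb_or => /andP[n1 n2]; exists c1; rewrite ?n1 ?n2 //= andbT.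
    by apply: contraTneq c1U => ->.
  have [c1 c1U] : exists2 c, c \in U & c \notin [:: c2; a] by apply: pick_avoiding.
  rewrite !inE negb_or => /andP[n1 n2]; exists c1; rewrite ?n1 ?n2 //=.
  by apply: contraTneq c1U => ->.
by exists c1, c2; split=> //; [exact: UX | solve_neqs].
Qed.

Lemma colour_K4 X1 X2 X3 X4 : 4 <= #|X1| -> 3 <= #|X2| -> 3 <= #|X3| -> 3 <= #|X4| ->
  exists c1 c2 c3 c4, [/\ c1 \in X1, c2 \in X2, c3 \in X3, c4 \in X4 &
    [&& c1 != c2, c1 != c3, c1 != c4, c2 != c3, c2 != c4 & c3 != c4]].
Proof.
move=> h1 h2 h3 h4.
have [c2 i2 _] : exists2 c, c \in X2 & c \notin [::] by apply: pick_avoiding; apply: ltnW (ltnW _).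
have [c3 i3] : exists2 c, c \in X3 & c \notin [:: c2] by apply: pick_avoiding; apply: ltnW.
rewrite !inE => n32.
have [c4 i4] : exists2 c, c \in X4 & c \notin [:: c2; c3] by apply: pick_avoiding.
rewrite !inE negb_or => /andP[n42 n43].
have [c1 i1] : exists2 c, c \in X1 & c \notin [:: c2; c3; c4] by apply: pick_avoiding.
rewrite !inE !negb_or => /and3P[n12 n13 n14].
by exists c1, c2, c3, c4; split=> //; solve_neqs.
Qed.

(** The conflicts form a [K4] on [u1], [u2], [v], [x], with [t] joined to [v] and [x]. A colour of
    [x] outside [T] costs [t] nothing, and greedy colouring works. Otherwise two colours of [Xx]
    serve both [x] and [t], and the remaining freedom puts [v] or [x] outside a 3-subset [U] of
    [U1], as [colour_pair] requires. *)
Lemma colour_triangle_edge (U1 U2 Xv Xx T : {set C}) :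
  3 <= #|U1| -> 3 <= #|U2| -> 4 <= #|Xv| -> 2 <= #|Xx| -> 2 <= #|T| ->
  exists u1 u2 v x t,
    [/\ [/\ u1 \in U1, u2 \in U2 & v \in Xv], x \in Xx, t \in T,
        [&& u1 != u2, u1 != v, u1 != x, u2 != v & u2 != x] &
        [&& v != x, t != v & t != x]].
Proof.
move=> hU1 hU2 hv hx hT.
have [/subsetP XT|/subsetPn[x xX xT]] := boolP (Xx \subset T); last first.
  have [u1 iu1] : exists2 c, c \in U1 & c \notin [:: x] by apply: pick_avoiding; apply: ltnW.
  rewrite !inE => n1x.
  have [u2 iu2] : exists2 c, c \in U2 & c \notin [:: u1; x] by apply: pick_avoiding.
  rewrite !inE negb_or => /andP[n21 n2x].
  have [v iv] : exists2 c, c \in Xv & c \notin [:: u1; u2; x] by apply: pick_avoiding.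
  rewrite !inE !negb_or => /and3P[nv1 nv2 nvx].
  have [t it] : exists2 c, c \in T & c \notin [:: v] by apply: pick_avoiding.
  rewrite inE => ntv; have ntx : t != x by apply: contraTneq it => ->.
  by exists u1, u2, v, x, t; split=> //; solve_neqs.
have [U UU1 U3] := subset_of_card hU1.
have [a aX _] : exists2 c, c \in Xx & c \notin [::] by apply: pick_avoiding; apply: ltnW.
have [b bX] : exists2 c, c \in Xx & c \notin [:: a] by apply: pick_avoiding.
rewrite inE => nba.
suff [v [x [t [iv xX tT vxU /and3P[vx tv tx]]]]] : exists v x t, [/\ v \in Xv, x \in Xx, t \in T,
    v \notin U \/ x \notin U & [&& v != x, t != v & t != x]].
  have [|u1 [u2 [iu1 iu2 nu]]] := colour_pair UU1 _ hU2 vxU; rewrite ?U3 //.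
  by exists u1, u2, v, x, t; split=> //; solve_neqs.
have [v vX] : exists2 v, v \in Xv & v \notin [:: a; b] by apply: pick_avoiding; apply: ltnW.
rewrite !inE negb_or => /andP[nva nvb].
have [aU|aU] := boolP (a \in U); last first.
  by exists v, a, b; split=> //; [exact: XT | right | solve_neqs].
have [bU|bU] := boolP (b \in U); last first.
  by exists v, b, a; split=> //; [exact: XT | right | solve_neqs].
have [w wX wU] : exists2 w, w \in Xv & w \notin U by apply: pick_outside; rewrite U3.
have nwa : w != a by apply: contraNneq wU => ->.
have nwb : w != b by apply: contraNneq wU => ->.
by exists w, a, b; split=> //; [exact: XT | left | solve_neqs].
Qed.

(** Choosing [x] outside a 3-subset of [U1] settles the first pair of leaves whatever [v] gets. Then
    [v'] is chosen so that [v'] or [x] is outside a 3-subset of [U1'], which settles the second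
    pair. *)
Lemma colour_two_triangles_apex (U1 U2 Xv Xx Xv' U1' U2' : {set C}) :
  3 <= #|U1| -> 3 <= #|U2| -> 4 <= #|Xv| -> 4 <= #|Xx| -> 4 <= #|Xv'| ->
  3 <= #|U1'| -> 3 <= #|U2'| ->
  exists u1 u2 v x v' u1' u2',
    [/\ [/\ u1 \in U1, u2 \in U2 & v \in Xv], [/\ x \in Xx, v' \in Xv', u1' \in U1' & u2' \in U2'],
        [&& u1 != u2, u1 != v, u1 != x, u2 != v & u2 != x],
        [&& v != x, v' != x & v != v'] &
        [&& u1' != u2', u1' != v', u1' != x, u2' != v' & u2' != x]].
Proof.
move=> hU1 hU2 hv hx hv' hU1' hU2'.
have [U UU1 U3] := subset_of_card hU1; have [U' UU1' U3'] := subset_of_card hU1'.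
have [x xX xU] : exists2 x, x \in Xx & x \notin U by apply: pick_outside; rewrite U3.
have [v' v'X [v'x vxU']] : exists2 v', v' \in Xv' & (v' != x) /\ (v' \notin U' \/ x \notin U').
  have [xU'|xU'] := boolP (x \in U').
    have [v' v'X v'U] : exists2 v', v' \in Xv' & v' \notin U' by apply: pick_outside; rewrite U3'.
    by exists v' => //; split; [apply: contraNneq v'U => -> | left].
  have [v' v'X] : exists2 v', v' \in Xv' & v' \notin [:: x] by apply: pick_avoiding; do 2!apply: ltnW.
  by rewrite inE => v'x; exists v' => //; split=> //; right.
have [v vX] : exists2 v, v \in Xv & v \notin [:: x; v'] by apply: pick_avoiding; apply: ltnW.
rewrite !inE negb_or => /andP[vx vv'].
have [|u1 [u2 [iu1 iu2 nu]]] := colour_pair UU1 _ hU2 (or_intror xU : v \notin U \/ _);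
  rewrite ?U3 //.
have [|u1' [u2' [iu1' iu2' nu']]] := colour_pair UU1' _ hU2' vxU'; rewrite ?U3' //.
by exists u1, u2, v, x, v', u1', u2'; split=> //; solve_neqs.
Qed.

End ListColours.

(** * Extending a colouring over deleted vertices *)

Section TwoDistance.
Variables (V : finType) (adj : rel V).
Hypothesis adjC : symmetric adj.
Hypothesis adj0 : irreflexive adj.
Implicit Types (A B : {set V}) (t u v w x y : V).

Definition nbrs A v : {set V} := [set w in A | adj v w].
(** The middle vertex must lie in [A]: this is distance at most 2 in the induced subgraph, not in
    the whole graph. *)
Definition conflict A u v : bool :=
  (u != v) && (adj u v || [exists w in A, adj u w && adj w v]).

Definition list_colorable (C : finType) (L : V -> {set C}) A : Prop :=
  exists phi : V -> C, (forall v, v \in A -> phi v \in L v) /\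
    forall u v, u \in A -> v \in A -> conflict A u v -> phi u != phi v.

Lemma conflictC A u v : conflict A u v = conflict A v u.
Proof.
rewrite /conflict eq_sym adjC; congr (_ && (_ || _)).
by apply: eq_existsb => w; rewrite [adj u w]adjC [adj w v]adjC [adj w u && _]andbC.
Qed.

Lemma mem_nbrs A v w : (w \in nbrs A v) = (w \in A) && adj v w.
Proof. by rewrite inE. Qed.

Section Extension.
Variables (C : finType) (L : V -> {set C}) (A : {set V}) (S : seq V) (m : nat).

Let B := A :\: [set x in S].

(* Bounds how many colours the coloured vertices reached through the neighbour
   n of an uncoloured vertex can forbid. *)
Definition cost n : nat := if n \in S then #|nbrs B n| else #|nbrs A n|.

Lemma cost_le n : cost n <= #|nbrs A n|.
Proof.
rewrite /cost; case: ifP => // _; apply/subset_leq_card/subsetP => w.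
by rewrite !mem_nbrs inE => /andP[/andP[_ ->] ->].
Qed.

Definition ext y : {set V} := [set w in B | conflict A y w].

Lemma card_ext y : y \in S -> y \in A -> #|ext y| <= \sum_(n in nbrs A y) cost n.
Proof.
move=> yS yA.
(* Coloured vertices reached through [n]. For a kept [n], the vertex [n] itself enters and [y]
   leaves, so the size is the degree of [n]. *)
pose D n := if n \in S then nbrs B n else (n |: nbrs A n) :\ y.
have sub : ext y \subset \bigcup_(n in nbrs A y) D n.
  apply/subsetP => w; rewrite !inE => /andP[/andP[wS wA] /andP[yw yw2]].
  apply/bigcupP; case/orP: yw2 => [ayw|/exists_inP[n nA /andP[yn nw]]].
    by exists w; rewrite ?mem_nbrs ?wA // /D (negPf wS) !inE eq_sym yw eqxx.
  exists n; first by rewrite mem_nbrs nA.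
  rewrite /D; case: ifP => nS; first by rewrite mem_nbrs !inE wS wA.
  by rewrite !inE eq_sym yw wA nw orbT.
apply: leq_trans (subset_leq_card sub) _.
apply: leq_trans (_ : \sum_(n in nbrs A y) #|D n| <= _).
  elim/big_rec2: _ => [|n a U _ le1]; first by rewrite cards0.
  by apply: leq_trans (leq_card_setU _ _) _; rewrite leq_add2l.
apply: leq_sum => n; rewrite mem_nbrs /D /cost => /andP[nA yn]; case: ifP => // nS.
have := cardsD1 y (n |: nbrs A n); rewrite cardsU1 !inE yA adjC yn orbT adj0 andbF /=.
by move/eqP; rewrite eqn_add2l => /eqP->.
Qed.

(* As a deleted vertex has at most one remaining neighbour, no two remaining
   vertices are at distance 2 through deleted vertices only. *)
Lemma extend_coloring :
  uniq S -> {subset S <= A} -> {in S, forall y, #|nbrs B y| <= 1} ->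
  (forall v, m <= #|L v|) -> list_colorable L B ->
  (forall av : V -> {set C},
     {in S, forall y, m <= #|av y| + \sum_(n in nbrs A y) cost n} ->
     exists cs : seq C, [/\ size cs = size S, all2 (fun y c => c \in av y) S cs &
       pairwise (fun a b => conflict A a.1 b.1 ==> (a.2 != b.2)) (zip S cs)]) ->
  list_colorable L A.
Proof.
move=> US SA S1 Lm [phi [phiL phiB]] col.
pose av y := L y :\: [set phi w | w in ext y].
have [y yS|cs [szS avS pwS]] := col av.
  apply: leq_trans (Lm y) _; rewrite -(cardsID [set phi w | w in ext y] (L y)) addnC leq_add2l.
  apply: leq_trans (subset_leq_card (subsetIr _ _)) _.
  by apply: leq_trans (leq_imset_card _ _) _; apply: card_ext (SA y yS).
pose psi v := if v \in S then nth (phi v) cs (index v S) else phi v.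
have psiS v c0 : v \in S -> psi v = nth c0 cs (index v S).
  by move=> vS; rewrite /psi vS; apply: set_nth_default; rewrite szS index_mem.
have psi_av v : v \in S -> psi v \in av v.
  move=> vS; rewrite (psiS v (phi v) vS).
  move: avS; rewrite all2E => /andP[_ /allP/(_ (v, nth (phi v) cs (index v S)))]; apply.
  have <- : nth (v, phi v) (zip S cs) (index v S) = (v, nth (phi v) cs (index v S)).
    by rewrite nth_zip ?szS // nth_index.
  by rewrite mem_nth // size_zip szS minnn index_mem.
have psi_neq u v : u \in S -> v \in S -> index u S < index v S -> conflict A u v ->
    psi u != psi v.
  move=> uS vS lt_uv uv; rewrite (psiS u (phi u)) // (psiS v (phi u)) //.
  have /(pairwiseP (u, phi u))/(_ (index u S) (index v S)) := pwS.
  rewrite !inE size_zip szS minnn !index_mem uS vS => /(_ isT isT lt_uv).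
  by rewrite !nth_zip ?szS //= !nth_index // uv.
have psi_out u v : u \in S -> v \in B -> conflict A u v -> psi u != psi v.
  move=> uS vB uv; have := psi_av u uS; rewrite inE => /andP[+ _].
  apply: contra => /eqP->; move: (vB); rewrite !inE => /andP[vS _].
  by rewrite /psi (negPf vS) imset_f // inE vB uv.
exists psi; split=> [v vA|u v uA vA uv].
  have [vS|vS] := boolP (v \in S); first by
    have := psi_av v vS; rewrite [_ \in av _]inE => /andP[].
  by rewrite /psi (negPf vS); apply: phiL; rewrite !inE vS.
have [uS|uS] := boolP (u \in S); have [vS|vS] := boolP (v \in S).
- have [||iuv] := ltngtP (index u S) (index v S).
  + by move=> lt_uv; apply: psi_neq.
  + by move=> lt_uv; rewrite eq_sym; apply: psi_neq => //; rewrite conflictC.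
  + by case/andP: uv; rewrite -(nth_index u uS) iuv nth_index ?eqxx.
- by apply: psi_out => //; rewrite !inE vS.
- by rewrite eq_sym; apply: psi_out; rewrite ?inE ?uS ?uA // conflictC.
have uB : u \in B by rewrite !inE uS.
have vB : v \in B by rewrite !inE vS.
rewrite /psi (negPf uS) (negPf vS); apply: phiB => //.
case/andP: uv => uv /orP[a_uv|/exists_inP[w wA /andP[uw wv]]].
  by rewrite /conflict uv a_uv.
rewrite /conflict uv; apply/orP; right; apply/exists_inP; exists w; last by rewrite uw.
rewrite !inE wA andbT; apply/negP => wS.
have := S1 w wS; rewrite leqNgt => /negP; apply.
rewrite (cardsD1 u) (cardsD1 v) !inE uS vS uA vA wv eq_sym uv adjC uw /=.
by [].
Qed.

End Extension.

Lemma out_le A (S : seq V) y ns : uniq ns -> all (fun n => (n \in S) && (n \in nbrs A y)) ns ->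
  #|nbrs (A :\: [set x in S]) y| + size ns <= #|nbrs A y|.
Proof.
move=> Uns /allP nsS; rewrite -(card_uniqP Uns).
rewrite -[#|mem ns|]cardsE addnC -cardsUI [X in _ + X](_ : _ = 0) ?addn0.
  apply/subset_leq_card/subsetP => n; rewrite !inE => /orP[/nsS|].
    by rewrite !inE => /andP[_].
  by case/andP=> /andP[_ ->] ->.
apply/eqP; rewrite cards_eq0; apply/eqP/setP => n; rewrite !inE.
by apply/negP => /andP[/nsS/andP[nS _]]; rewrite nS.
Qed.

(** The neighbours outside [ns] number at most [d - size ns] and cost at most [k] each; the additive
    form avoids truncated subtraction. *)
Lemma sum_cost_le A (S : seq V) (k d : nat) y ns : (forall v, #|nbrs A v| <= k) ->
  uniq ns -> all (fun n => n \in nbrs A y) ns -> #|nbrs A y| <= d ->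
  \sum_(n in nbrs A y) cost A S n + size ns * k <= \sum_(n <- ns) cost A S n + d * k.
Proof.
move=> degk Uns /allP nsN le_d.
have costk n : cost A S n <= k by apply: leq_trans (cost_le _ _ _) (degk n).
rewrite (bigID (fun n => n \in ns)) /=.
have -> : \sum_(n in nbrs A y | n \in ns) cost A S n = \sum_(n <- ns) cost A S n.
  rewrite -big_filter; apply: perm_big; apply: uniq_perm; rewrite ?filter_uniq ?index_enum_uniq // => n.
  rewrite mem_filter mem_index_enum andbT.
  by case: (boolP (n \in ns)) => [/nsN->|]; rewrite ?andbF.
rewrite -addnA leq_add2l.
apply: leq_trans (_ : #|nbrs A y| * k <= _); last by rewrite leq_mul2r le_d orbT.
rewrite -(cardsID [set n in ns] (nbrs A y)) mulnDl addnC leq_add //.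
  rewrite leq_mul2r; apply/orP; right; rewrite -(card_uniqP Uns) -[#|mem ns|]cardsE.
  by apply/subset_leq_card/subsetP => n; rewrite !inE => nn; rewrite nn andbT;
    have := nsN n nn; rewrite inE.
rewrite -sum_nat_const big_mkcond [leqRHS]big_mkcond leq_sum // => n _ /=.
by rewrite !inE andbC; case: ifP.
Qed.

Lemma out_le_sub A (S : seq V) y ns (d : nat) : uniq ns ->
  all (fun n => (n \in S) && (n \in nbrs A y)) ns -> #|nbrs A y| <= d ->
  #|nbrs (A :\: [set x in S]) y| <= d - size ns.
Proof. by move=> Uns nsS le_d; have := out_le Uns nsS; move: le_d; clear; lia. Qed.

Lemma avail_ge A (S : seq V) (k m : nat) y ns (b a : nat) : (forall v, #|nbrs A v| <= k) ->
  uniq ns -> all (fun n => n \in nbrs A y) ns -> #|nbrs A y| <= size ns + b ->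
  m <= a + \sum_(n in nbrs A y) cost A S n ->
  m <= a + \sum_(n <- ns) cost A S n + b * k.
Proof.
move=> degk Uns nsN le_d; have := sum_cost_le S degk Uns nsN le_d.
by rewrite mulnDl; clear; lia.
Qed.

(** * Configurations absent from a minimal counterexample *)

Section Reductions.
Variables (k : nat) (A : {set V}).
Hypothesis k4 : 4 <= k.
Hypothesis degk : forall v, #|nbrs A v| <= k.
Hypothesis no_short_cycle : forall c, ucycle adj c -> 3 <= size c -> 8 <= size c.

Lemma no_cycle (c : seq V) : cycle adj c -> uniq c -> 3 <= size c <= 7 -> False.
Proof.
move=> cyc Uc /andP[c3 c7]; have := no_short_cycle (c := c).
by rewrite /ucycle cyc Uc => /(_ isT c3); rewrite leqNgt ltnS c7.
Qed.

Lemma adj_neq u v : adj u v -> u != v.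
Proof. by apply: contraTneq => ->; rewrite adj0. Qed.

Lemma no_triangle a b c : adj a b -> adj b c -> adj a c -> False.
Proof.
move=> ab bc ac; apply: (@no_cycle [:: a; b; c]) => //=; first by rewrite ab bc adjC ac.
by rewrite !inE negb_or !adj_neq.
Qed.

(** Otherwise there would be a cycle of length at most 5. *)
Lemma path3 a b c d : adj a b -> adj b c -> adj c d -> a != c -> b != d ->
  [/\ a != d, ~~ adj a d & ~~ conflict A a d].
Proof.
move=> ab bc cd ac bd.
have ad : a != d by apply/eqP => E; apply: (no_triangle ab bc); rewrite E adjC.
have nad : ~~ adj a d.
  apply/negP => aad; apply: (@no_cycle [:: a; b; c; d]) => //=; first by rewrite ab bc cd adjC aad.
  by rewrite !inE !negb_or ad ac bd !adj_neq.
split=> //; rewrite /conflict negb_and (negPf nad) /=; apply/orP; right.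
apply/negP => /exists_inP[z _ /andP[az zd]].
have bz : b != z by apply/eqP => E; apply: (no_triangle bc cd); rewrite E.
have cz : c != z by apply/eqP => E; apply: (no_triangle ab bc); rewrite E.
apply: (@no_cycle [:: a; b; c; d; z]) => //=.
  by rewrite ab bc cd (adjC d) zd adjC az.
by rewrite !inE !negb_or ad ac bd bz cz !adj_neq // adjC.
Qed.

(** Otherwise there would be a cycle of length at most 6. *)
Lemma path4 a b c d e : adj a b -> adj b c -> adj c d -> adj d e ->
  a != c -> b != d -> c != e -> a != e /\ ~~ conflict A a e.
Proof.
move=> ab bc cd de ac bd ce.
have [ad nad _] := path3 ab bc cd ac bd; have [be nbe _] := path3 bc cd de bd ce.
have ae : a != e by apply: contraNneq nbe => <-; rewrite adjC.
have nae : ~~ adj a e.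
  apply/negP => aae; apply: (@no_cycle [:: a; b; c; d; e]) => //=.
    by rewrite ab bc cd de adjC aae.
  by rewrite !inE !negb_or ad ac ae bd be ce !adj_neq.
split=> //; rewrite /conflict negb_and (negPf nae) /=; apply/orP; right.
apply/negP => /exists_inP[z _ /andP[az ze]].
have bz : b != z by apply: contraNneq nbe => ->.
have cz : c != z by apply/eqP => E; apply: (no_triangle ab bc); rewrite E.
have dz : d != z by apply: contraNneq nad => ->.
apply: (@no_cycle [:: a; b; c; d; e; z]) => //=.
  by rewrite ab bc cd de (adjC e) ze adjC az.
by rewrite !inE !negb_or ad ac ae bd be bz ce cz dz !adj_neq // adjC.
Qed.

Definition reducible (S : seq V) : Prop :=
  forall (C : finType) (L : V -> {set C}), (forall v, k + 3 <= #|L v|) ->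
  list_colorable L (A :\: [set x in S]) -> list_colorable L A.

Lemma reducibleI S : uniq S -> all [in A] S ->
  all (fun y => #|nbrs (A :\: [set x in S]) y| <= 1) S ->
  (forall (C : finType) (av : V -> {set C}),
     all (fun y => k + 3 <= #|av y| + \sum_(n in nbrs A y) cost A S n) S ->
     exists cs : seq C, [/\ size cs = size S, all2 (fun y c => c \in av y) S cs &
       pairwise (fun a b => conflict A a.1 b.1 ==> (a.2 != b.2)) (zip S cs)]) ->
  reducible S.
Proof.
move=> US /allP SA /allP S1 col C L Lk colB.
apply: extend_coloring US SA S1 Lk colB _ => av avk.
by apply: col; apply/allP.
Qed.

Lemma costE S n : n \in S -> cost A S n = #|nbrs (A :\: [set x in S]) n|.
Proof. by rewrite /cost => ->. Qed.

(** Of the two neighbours of [u], the deleted [v] costs at most [e] and the other at most [k], so at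
    least [3 - e] of the [k + 3] colours remain. *)
Lemma avail_deg2 (S : seq V) u v (e a : nat) : v \in S -> v \in nbrs A u -> #|nbrs A u| <= 2 ->
  #|nbrs (A :\: [set x in S]) v| <= e ->
  k + 3 <= a + \sum_(n in nbrs A u) cost A S n -> 3 <= a + e.
Proof.
move=> vS M d le_e h; have nsN : all [in nbrs A u] [:: v] by rewrite /= M.
have := @avail_ge A S k _ u [:: v] 1 _ degk isT nsN d h; rewrite big_seq1 costE //.
by move: le_e; clear; lia.
Qed.

Lemma out_deg2 (S : seq V) u v : v \in S -> v \in nbrs A u -> #|nbrs A u| <= 2 ->
  #|nbrs (A :\: [set x in S]) u| <= 1.
Proof. by move=> vS M; apply: (@out_le_sub A S u [:: v] 2) => //=; rewrite vS M. Qed.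

Lemma reducible_leaf v : v \in A -> #|nbrs A v| <= 1 -> reducible [:: v].
Proof.
move=> vA v1; apply: reducibleI => //=; first by rewrite vA.
  by have := @out_le A [:: v] v [::] isT isT; rewrite /=; lia.
move=> C av; rewrite andbT => avk.
have := @sum_cost_le A [:: v] k 1 v [::] degk isT isT v1; rewrite big_nil /= => h.
have [c cv _] : exists2 c, c \in av v & c \notin [::] by apply: pick_avoiding => /=; lia.
by exists [:: c]; rewrite /= cv.
Qed.

Lemma reducible_edge22 u v : u \in A -> v \in A -> adj u v ->
  #|nbrs A u| <= 2 -> #|nbrs A v| <= 2 -> reducible [:: u; v].
Proof.
set S := [:: _; _]; move=> uA vA uv d1 d2.
have M1 : v \in nbrs A u by rewrite mem_nbrs vA.
have M2 : u \in nbrs A v by rewrite mem_nbrs uA adjC.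
have [iu iv] : u \in S /\ v \in S by rewrite !inE !eqxx orbT.
have ou := out_deg2 iv M1 d1; have ov := out_deg2 iu M2 d2.
apply: reducibleI; rewrite /= ?uA ?vA ?ou ?ov //; first by rewrite inE adj_neq.
move=> C av /and3P[/(avail_deg2 iv M1 d1 ov) hu /(avail_deg2 iu M2 d2 ou) hv _].
rewrite !addn1 !ltnS in hu hv.
have [c cu _] : exists2 c, c \in av u & c \notin [::] by apply: pick_avoiding; apply: ltnW.
have [d dv] : exists2 d, d \in av v & d \notin [:: c] by apply: pick_avoiding.
rewrite inE eq_sym => cd.
by exists [:: c; d]; rewrite /= cu dv cd implybT.
Qed.

(** Each [u_i] costs [v] at most 1, leaving [k >= 4] colours; [v] has no neighbour left, so each
    [u_i] keeps 3. This suffices even for four pairwise conflicting vertices. *)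
Lemma reducible_three2 v u1 u2 u3 : all [in A] [:: v; u1; u2; u3] ->
  adj v u1 -> adj v u2 -> adj v u3 -> u1 != u2 -> u1 != u3 -> u2 != u3 ->
  #|nbrs A v| <= 3 -> #|nbrs A u1| <= 2 -> #|nbrs A u2| <= 2 -> #|nbrs A u3| <= 2 ->
  reducible [:: v; u1; u2; u3].
Proof.
set S := [:: _; _; _; _].
move=> SA vu1 vu2 vu3 n12 n13 n23 v3 d1 d2 d3.
have /and5P[vA u1A u2A u3A _] := SA.
have N1 : u1 \in nbrs A v by rewrite mem_nbrs u1A.
have N2 : u2 \in nbrs A v by rewrite mem_nbrs u2A.
have N3 : u3 \in nbrs A v by rewrite mem_nbrs u3A.
have M1 : v \in nbrs A u1 by rewrite mem_nbrs vA adjC.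
have M2 : v \in nbrs A u2 by rewrite mem_nbrs vA adjC.
have M3 : v \in nbrs A u3 by rewrite mem_nbrs vA adjC.
have [iv i1 i2 i3] : [/\ v \in S, u1 \in S, u2 \in S & u3 \in S].
  by rewrite !inE !eqxx !orbT.
have ov : #|nbrs (A :\: [set x in S]) v| <= 0.
  apply: (@out_le_sub A S v [:: u1; u2; u3] 3) => //=.
    by rewrite !inE negb_or n12 n13 n23.
  by rewrite i1 i2 i3 N1 N2 N3.
have o1 := out_deg2 iv M1 d1; have o2 := out_deg2 iv M2 d2; have o3 := out_deg2 iv M3 d3.
apply: reducibleI => //.
- by rewrite /= !inE !negb_or n12 n13 n23 !adj_neq.
- by rewrite /= o1 o2 o3 (leq_trans ov).
move=> C av /and5P[hv h1 h2 h3 _].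
have {}hv : 4 <= #|av v|.
  have Uns : uniq [:: u1; u2; u3] by rewrite /= !inE negb_or n12 n13 n23.
  have nsN : all [in nbrs A v] [:: u1; u2; u3] by rewrite /= N1 N2 N3.
  have := @avail_ge A S k _ v _ 0 _ degk Uns nsN v3 hv; rewrite !big_cons big_nil !costE //.
  by move: o1 o2 o3 k4; clear; lia.
move: h1 h2 h3 => /(avail_deg2 iv M1 d1 ov) h1 /(avail_deg2 iv M2 d2 ov) h2.
move=> /(avail_deg2 iv M3 d3 ov) h3; rewrite !addn0 in h1 h2 h3.
have [c [c1 [c2 [c3 [ic ic1 ic2 ic3]]]]] := colour_K4 hv h1 h2 h3.
case/and5P=> m1 m2 m3 m4 /andP[m5 m6].
by exists [:: c; c1; c2; c3]; rewrite /= ic ic1 ic2 ic3 m1 m2 m3 m4 m5 m6 !implybT.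
Qed.

Lemma avail_deg3 (S : seq V) v (a b c : V) (n : nat) : uniq [:: a; b; c] ->
  [/\ a \in nbrs A v, b \in nbrs A v & c \in nbrs A v] -> #|nbrs A v| <= 3 ->
  k + 3 <= n + \sum_(x in nbrs A v) cost A S x ->
  k + 3 <= n + (cost A S a + cost A S b + cost A S c).
Proof.
move=> U [Na Nb Nc] d h; have nsN : all [in nbrs A v] [:: a; b; c] by rewrite /= Na Nb Nc.
have := @avail_ge A S k _ v _ 0 _ degk U nsN d h; rewrite !big_cons big_nil.
by clear; lia.
Qed.

Lemma out_deg3 (S : seq V) v (a b c : V) : uniq [:: a; b; c] -> [/\ a \in S, b \in S & c \in S] ->
  [/\ a \in nbrs A v, b \in nbrs A v & c \in nbrs A v] -> #|nbrs A v| <= 3 ->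
  #|nbrs (A :\: [set x in S]) v| <= 0.
Proof.
move=> U [aS bS cS] [Na Nb Nc]; apply: (@out_le_sub A S v [:: a; b; c] 3) => //=.
by rewrite aS bS cS Na Nb Nc.
Qed.

Lemma out_deg3_two (S : seq V) v (a b : V) : a != b -> a \in S -> b \in S ->
  a \in nbrs A v -> b \in nbrs A v -> #|nbrs A v| <= 3 ->
  #|nbrs (A :\: [set x in S]) v| <= 1.
Proof.
move=> ab aS bS Na Nb; apply: (@out_le_sub A S v [:: a; b] 3) => //=; first by rewrite inE ab.
by rewrite aS bS Na Nb.
Qed.

Lemma mem_nbrsC u v : u \in A -> adj v u -> u \in nbrs A v.
Proof. by move=> uA vu; rewrite mem_nbrs uA. Qed.

Lemma uniq3 (a b c : V) : a != b -> a != c -> b != c -> uniq [:: a; b; c].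
Proof. by move=> ab ac bc; rewrite /= !inE negb_or ab ac bc. Qed.

(** Remaining colours: 3 for [u1] and [u2], [k >= 4] for [v], 2 for [x] (its third neighbour may
    cost [k]), 2 for [t]. By [path3] the [u_i] do not conflict with [t]. *)
Lemma reducible_triangle_edge u1 u2 v x t : all [in A] [:: u1; u2; v; x; t] ->
  adj v x -> adj v u1 -> adj v u2 -> adj x t ->
  u1 != u2 -> u1 != x -> u2 != x -> t != v ->
  #|nbrs A v| <= 3 -> #|nbrs A x| <= 3 -> #|nbrs A u1| <= 2 -> #|nbrs A u2| <= 2 ->
  #|nbrs A t| <= 2 -> reducible [:: u1; u2; v; x; t].
Proof.
set S := [:: _; _; _; _; _]; move=> SA vx vu1 vu2 xt.
move=> nu12 nu1x nu2x ntv dv dx du1 du2 dt.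
have /and5P[u1A u2A vA xA /andP[tA _]] := SA.
have xv : adj x v by rewrite adjC.
have u1v : adj u1 v by rewrite adjC.
have u2v : adj u2 v by rewrite adjC.
have tx : adj t x by rewrite adjC.
have [[iu1 iu2 iv] ix it] : [/\ [/\ u1 \in S, u2 \in S & v \in S], x \in S & t \in S].
  by rewrite !inE !eqxx !orbT.
have nvt : v != t by rewrite eq_sym.
have [n1 _ c1] := path3 u1v vx xt nu1x nvt.
have [n2 _ c2] := path3 u2v vx xt nu2x nvt.
have Uv := uniq3 nu12 nu1x nu2x.
have Nv : [/\ u1 \in nbrs A v, u2 \in nbrs A v & x \in nbrs A v] by rewrite !mem_nbrsC.
have ov := out_deg3 Uv (And3 iu1 iu2 ix) Nv dv.
have ox := out_deg3_two nvt iv it (mem_nbrsC vA xv) (mem_nbrsC tA xt) dx.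
have ou1 := out_deg2 iv (mem_nbrsC vA u1v) du1.
have ou2 := out_deg2 iv (mem_nbrsC vA u2v) du2.
have ot := out_deg2 ix (mem_nbrsC xA tx) dt.
apply: reducibleI => //.
- by rewrite /= !inE !negb_or nu12 nu1x nu2x nvt n1 n2 !adj_neq.
- by rewrite /= ou1 ou2 (leq_trans ov) // ox ot.
move=> C av /and5P[].
move=> /(avail_deg2 iv (mem_nbrsC vA u1v) du1 ov) hu1 /(avail_deg2 iv (mem_nbrsC vA u2v) du2 ov) hu2.
move=> /(avail_deg3 Uv Nv dv) hv hx /andP[/(avail_deg2 ix (mem_nbrsC xA tx) dt ox) ht _].
rewrite ?addn0 ?addn1 ?ltnS in hu1 hu2 ht.
have {}hv : 4 <= #|av v| by move: hv; rewrite !costE //; move: ou1 ou2 ox k4; clear; lia.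
have {}hx : 2 <= #|av x|.
  have nsN : all [in nbrs A x] [:: v; t] by rewrite /= !mem_nbrsC.
  have U : uniq [:: v; t] by rewrite /= inE nvt.
  have := @avail_ge A S k _ x _ 1 _ degk U nsN dx hx; rewrite !big_cons big_nil !costE //.
  by move: ov ot; clear; lia.
have [a1 [a2 [b [c [d [[i1 i2 i3] i4 i5 H1 H2]]]]]] := colour_triangle_edge hu1 hu2 hv hx ht.
exists [:: a1; a2; b; c; d]; split=> //=; first by rewrite i1 i2 i3 i4 i5.
case/and5P: H1 => m1 m2 m3 m4 m5; case/and3P: H2 => l1 l2 l3.
rewrite (negPf c1) (negPf c2) m1 m2 m3 m4 m5 l1.
by rewrite [b == d]eq_sym [c == d]eq_sym l2 l3 !implybT.
Qed.

(** The third neighbour [y] of [x] is kept but costs at most 3, so [x] retains [k >= 4] colours,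
    like [v] and [v']; the four leaves retain 3. [path3] and [path4] exclude conflicts between
    leaves of one side and the vertices of the other. *)
Lemma reducible_two_triangles_apex u1 u2 v x v' w1 w2 y :
  all [in A] [:: u1; u2; v; x; v'; w1; w2] -> y \in A ->
  adj v x -> adj v u1 -> adj v u2 -> adj v' x -> adj v' w1 -> adj v' w2 -> adj x y ->
  u1 != u2 -> u1 != x -> u2 != x -> w1 != w2 -> w1 != x -> w2 != x ->
  v != v' -> v != y -> v' != y ->
  #|nbrs A v| <= 3 -> #|nbrs A x| <= 3 -> #|nbrs A v'| <= 3 -> #|nbrs A y| <= 3 ->
  #|nbrs A u1| <= 2 -> #|nbrs A u2| <= 2 -> #|nbrs A w1| <= 2 -> #|nbrs A w2| <= 2 ->
  reducible [:: u1; u2; v; x; v'; w1; w2].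
Proof.
set S := [:: _; _; _; _; _; _; _]; move=> SA yA vx vu1 vu2 v'x vw1 vw2 xy.
move=> nu12 nu1x nu2x nw12 nw1x nw2x nvv nvy nvy' dv dx dv' dy du1 du2 dw1 dw2.
have /and5P[u1A u2A vA xA /and4P[v'A w1A w2A _]] := SA.
have xv : adj x v by rewrite adjC.
have xv' : adj x v' by rewrite adjC.
have u1v : adj u1 v by rewrite adjC.
have u2v : adj u2 v by rewrite adjC.
have w1v : adj w1 v' by rewrite adjC.
have w2v : adj w2 v' by rewrite adjC.
have [[iu1 iu2 iv] ix [iv' iw1 iw2]] : [/\ [/\ u1 \in S, u2 \in S & v \in S], x \in S &
    [/\ v' \in S, w1 \in S & w2 \in S]] by rewrite !inE !eqxx !orbT.
have nxw1 : x != w1 by rewrite eq_sym.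
have nxw2 : x != w2 by rewrite eq_sym.
have [p1 _ c1] := path3 u1v vx xv' nu1x nvv.
have [p2 _ c2] := path3 u2v vx xv' nu2x nvv.
have [q1 _ e1] := path3 vx xv' vw1 nvv nxw1.
have [q2 _ e2] := path3 vx xv' vw2 nvv nxw2.
have [n11 c11] := path4 u1v vx xv' vw1 nu1x nvv nxw1.
have [n12 c12] := path4 u1v vx xv' vw2 nu1x nvv nxw2.
have [n21 c21] := path4 u2v vx xv' vw1 nu2x nvv nxw1.
have [n22 c22] := path4 u2v vx xv' vw2 nu2x nvv nxw2.
have Uv := uniq3 nu12 nu1x nu2x; have Uv' := uniq3 nw12 nw1x nw2x.
have Nv : [/\ u1 \in nbrs A v, u2 \in nbrs A v & x \in nbrs A v] by rewrite !mem_nbrsC.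
have Nv' : [/\ w1 \in nbrs A v', w2 \in nbrs A v' & x \in nbrs A v'] by rewrite !mem_nbrsC.
have Nx : [/\ v \in nbrs A x, v' \in nbrs A x & y \in nbrs A x] by rewrite !mem_nbrsC.
have ov := out_deg3 Uv (And3 iu1 iu2 ix) Nv dv.
have ov' := out_deg3 Uv' (And3 iw1 iw2 ix) Nv' dv'.
have ox := out_deg3_two nvv iv iv' (mem_nbrsC vA xv) (mem_nbrsC v'A xv') dx.
have ou1 := out_deg2 iv (mem_nbrsC vA u1v) du1.
have ou2 := out_deg2 iv (mem_nbrsC vA u2v) du2.
have ow1 := out_deg2 iv' (mem_nbrsC v'A w1v) dw1.
have ow2 := out_deg2 iv' (mem_nbrsC v'A w2v) dw2.
apply: reducibleI => //.
- rewrite /= !inE !negb_or nu12 nu1x nu2x nw12 nxw1 nxw2 nvv p1 p2 q1 q2 n11 n12 n21 n22.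
  by rewrite !adj_neq.
- by rewrite /= ou1 ou2 (leq_trans ov) // ox (leq_trans ov') // ow1 ow2.
move=> C av /and5P[].
move=> /(avail_deg2 iv (mem_nbrsC vA u1v) du1 ov) hu1 /(avail_deg2 iv (mem_nbrsC vA u2v) du2 ov) hu2.
move=> /(avail_deg3 Uv Nv dv) hv /(avail_deg3 (uniq3 nvv nvy nvy') Nx dx) hx.
move=> /and4P[/(avail_deg3 Uv' Nv' dv') hv'].
move=> /(avail_deg2 iv' (mem_nbrsC v'A w1v) dw1 ov') hw1 /(avail_deg2 iv' (mem_nbrsC v'A w2v) dw2 ov') hw2 _.
rewrite !addn0 in hu1 hu2 hw1 hw2.
have {}hv : 4 <= #|av v| by move: hv; rewrite !costE //; move: ou1 ou2 ox k4; clear; lia.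
have {}hv' : 4 <= #|av v'| by move: hv'; rewrite !costE //; move: ow1 ow2 ox k4; clear; lia.
have {}hx : 4 <= #|av x|.
  have cy : cost A S y <= 3 by apply: leq_trans (cost_le _ _ _) dy.
  by move: hx; rewrite (costE iv) (costE iv'); move: ov ov' cy k4; clear; lia.
have [a1 [a2 [b [c [b' [d1 [d2 [[i1 i2 i3] [i4 i5 i6 i7] H1 H2 H3]]]]]]]] :=
  colour_two_triangles_apex hu1 hu2 hv hx hv' hw1 hw2.
exists [:: a1; a2; b; c; b'; d1; d2]; split=> //=; first by rewrite i1 i2 i3 i4 i5 i6 i7.
case/and5P: H1 => m1 m2 m3 m4 m5; case/and3P: H2 => l1 l2 l3; case/and5P: H3 => r1 r2 r3 r4 r5.
rewrite (negPf c1) (negPf c2) (negPf e1) (negPf e2) (negPf c11) (negPf c12) (negPf c21) (negPf c22).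
rewrite m1 m2 m3 m4 m5 l1 l3 r1 ![c == _]eq_sym l2 r3 r5 ![b' == _]eq_sym r2 r4.
by rewrite !implybT.
Qed.

End Reductions.
End TwoDistance.

(** * Discharging *)

(** The balance at a vertex of degree 3, in thirds: it owns [3 * 3 - 8 = 1]. All degrees above 3
    behave alike, so finitely many cases remain. *)
Lemma deg3_balance (da db dc : nat) (aB bB cB vB : bool) :
  [&& 1 < da, 1 < db & 1 < dc] ->
  [&& aB ==> (da == 3), bB ==> (db == 3) & cB ==> (dc == 3)] ->
  [&& (da == 2) ==> ~~ bB && ~~ cB, (db == 2) ==> ~~ aB && ~~ cB & (dc == 2) ==> ~~ aB && ~~ bB] ->
  [&& aB && bB ==> (3 < dc), aB && cB ==> (3 < db) & bB && cB ==> (3 < da)] ->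
  ~~ [&& da == 2, db == 2 & dc == 2] ->
  (1 < (da == 2) + (db == 2) + (dc == 2)) ==> vB ->
  ((da == 2) || aB) + ((db == 2) || bB) + ((dc == 2) || cB) <=
  1 + (((3 < da) || (da == 3) && vB) + ((3 < db) || (db == 3) && vB) + ((3 < dc) || (dc == 3) && vB)).
Proof.
case: da => [|[|[|[|da]]]]; case: db => [|[|[|[|db]]]]; case: dc => [|[|[|[|dc]]]] //;
  by case: aB => //; case: bB => //; case: cB => //; case: vB.
Qed.

Section Discharging.
Variables (V : finType) (adj : rel V) (k : nat) (A : {set V}).
Hypothesis adjC : symmetric adj.
Hypothesis adj0 : irreflexive adj.
Hypothesis k4 : 4 <= k.
Hypothesis degk : forall v, #|nbrs adj A v| <= k.
Hypothesis no_short_cycle : forall c, ucycle adj c -> 3 <= size c -> 8 <= size c.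
Hypothesis irreducible : forall S, S != [::] -> all [in A] S -> ~ reducible adj k A S.

Let N v := nbrs adj A v.
Let d v := #|N v|.
Let bad v := (d v == 3) && (1 < #|[set u in N v | d u == 2]|).
Let gives v w := (3 < d v) || (d v == 3) && ((d w == 2) || bad w).

Lemma N_A v w : w \in N v -> w \in A.
Proof. by rewrite mem_nbrs => /andP[]. Qed.

Lemma N_adj v w : w \in N v -> adj v w.
Proof. by rewrite mem_nbrs => /andP[]. Qed.

Lemma deg_gt1 v : v \in A -> 1 < d v.
Proof.
move=> vA; rewrite ltnNge; apply/negP => v1.
by apply: (irreducible (S := [:: v])) (reducible_leaf adjC adj0 k4 degk vA v1); rewrite /= ?vA.
Qed.

Lemma deg2_nbr v w : v \in A -> w \in N v -> d v = 2 -> 2 < d w.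
Proof.
move=> vA wv v2; have wA := N_A wv; rewrite ltn_neqAle deg_gt1 // andbT eq_sym.
apply/eqP => w2; apply: (irreducible (S := [:: v; w])); rewrite /= ?vA ?wA //.
by apply: reducible_edge22 => //; [exact: N_adj | rewrite -/(N v) -/(d v) v2 | rewrite -/(N w) -/(d w) w2].
Qed.

Lemma badP v : bad v -> d v = 3 /\ exists u1 u2,
  [/\ u1 \in N v, u2 \in N v, u1 != u2, d u1 = 2 & d u2 = 2].
Proof.
case/andP=> /eqP v3 /card_gt1P[u1 [u2 [h1 h2 u12]]]; split=> //; exists u1, u2.
by move: h1 h2; rewrite ![_ \in [set u in _ | _]]inE => /andP[? /eqP ?] /andP[? /eqP ?].
Qed.

(** A bad [q] would give [reducible_triangle_edge], with [q] carrying the two leaves, [v] in the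
    role of [x] and [p] in that of [t]. *)
Lemma bad_next_to_2 v p q : v \in A -> d v = 3 -> p \in N v -> q \in N v ->
  d p = 2 -> ~~ bad q.
Proof.
move=> vA v3 pv qv p2; apply/negP => /badP[q3 [u1 [u2 [u1q u2q u12 u1d u2d]]]].
have [pA qA] := (N_A pv, N_A qv); have [u1A u2A] := (N_A u1q, N_A u2q).
have SA : all [in A] [:: u1; u2; q; v; p] by rewrite /= u1A u2A qA vA pA.
apply: (irreducible _ SA) => //.
apply: reducible_triangle_edge => //; rewrite ?[adj q v]adjC ?N_adj //.
- by apply: contra_eq_neq u1d => ->; rewrite v3.
- by apply: contra_eq_neq u2d => ->; rewrite v3.
- by apply: contra_eq_neq p2 => ->; rewrite q3.
- by rewrite -/(N q) -/(d q) q3.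
- by rewrite -/(N v) -/(d v) v3.
- by rewrite -/(N u1) -/(d u1) u1d.
- by rewrite -/(N u2) -/(d u2) u2d.
- by rewrite -/(N p) -/(d p) p2.
Qed.

Lemma two_bad_nbrs v p q r : v \in A -> d v = 3 -> p \in N v -> q \in N v -> r \in N v ->
  p != q -> p != r -> q != r -> bad p -> bad q -> 3 < d r.
Proof.
move=> vA v3 pv qv rv pq pr qr /badP[p3 [u1 [u2 [u1p u2p u12 u1d u2d]]]].
case/badP=> [q3 [w1 [w2 [w1q w2q w12 w1d w2d]]]].
have [pA qA] := (N_A pv, N_A qv); have [u1A u2A] := (N_A u1p, N_A u2p).
have [w1A w2A] := (N_A w1q, N_A w2q).
have SA : all [in A] [:: u1; u2; p; v; q; w1; w2] by rewrite /= u1A u2A pA vA qA w1A w2A.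
rewrite ltnNge; apply/negP => r3; apply: (irreducible _ SA) => //.
have n2v u : d u = 2 -> u != v by move=> du; apply: contra_eq_neq du => ->; rewrite v3.
apply: (reducible_two_triangles_apex adjC adj0 k4 degk no_short_cycle SA (N_A rv)) => //;
  rewrite ?[adj p v]adjC ?[adj q v]adjC ?N_adj ?n2v ?(N_A rv) //.
- by rewrite -/(N p) -/(d p) p3.
- by rewrite -/(N v) -/(d v) v3.
- by rewrite -/(N q) -/(d q) q3.
- by rewrite -/(N u1) -/(d u1) u1d.
- by rewrite -/(N u2) -/(d u2) u2d.
- by rewrite -/(N w1) -/(d w1) w1d.
- by rewrite -/(N w2) -/(d w2) w2d.
Qed.

Lemma three_nbrs_not_2 v p q r : v \in A -> d v = 3 -> p \in N v -> q \in N v -> r \in N v ->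
  p != q -> p != r -> q != r -> ~~ [&& d p == 2, d q == 2 & d r == 2].
Proof.
move=> vA v3 pv qv rv pq pr qr; apply/negP => /and3P[/eqP p2 /eqP q2 /eqP r2].
have SA : all [in A] [:: v; p; q; r] by rewrite /= vA (N_A pv) (N_A qv) (N_A rv).
apply: (irreducible _ SA) => //; apply: reducible_three2 => //; rewrite ?N_adj //.
- by rewrite -/(N v) -/(d v) v3.
- by rewrite -/(N p) -/(d p) p2.
- by rewrite -/(N q) -/(d q) q2.
- by rewrite -/(N r) -/(d r) r2.
Qed.

(** Final charge in thirds. Degree 2 receives from both neighbours and gives nothing; degree at
    least 4 gives at most [d v <= 3 * d v - 8]; degree 3 is [deg3_balance]. *)
Lemma charge_ge0 v : v \in A ->
  8 + \sum_(w in N v) gives v w <= 3 * d v + \sum_(w in N v) gives w v.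
Proof.
move=> vA; have := deg_gt1 vA; rewrite leq_eqVlt => /predU1P[v2|].
  rewrite big1 => [|w _]; last by rewrite /gives -v2.
  have -> : \sum_(w in N v) gives w v = d v; last by rewrite -v2.
  rewrite /d -sum1_card; apply: eq_bigr => w wv.
  by have := deg2_nbr vA wv (esym v2); rewrite /gives -v2 leq_eqVlt eq_sym => /orP[->|->]; rewrite ?orbT.
rewrite leq_eqVlt => /predU1P[v3|v4]; last first.
  have out : \sum_(w in N v) gives v w <= d v.
    by rewrite /d -sum1_card leq_sum // => w _; case: (gives v w).
  by move: out v4; clear; lia.
have [a [b [c [abc Nabc]]]] : exists a b c, [&& a != b, a != c & b != c] /\
    N v =i [:: a; b; c].
  have := enum_uniq (N v); have := cardE (N v); rewrite -/(d v) -v3.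
  have : N v =i enum (N v) by move=> w; rewrite mem_enum.
  case: (enum _) => [|a [|b [|c [|? ?]]]] //= H _ U; exists a, b, c; split=> //.
  by move: U; rewrite !inE negb_or -andbA andbT.
case/and3P: abc => ab ac bc.
have [av bv cv] : [/\ a \in N v, b \in N v & c \in N v] by rewrite !Nabc !inE !eqxx !orbT.
have sumN (f : V -> nat) : \sum_(w in N v) f w = f a + f b + f c.
  rewrite (eq_bigl (fun w => w \in [:: a; b; c])) //.
  rewrite -big_uniq /=; last by rewrite !inE negb_or ab ac bc.
  by rewrite !big_cons big_nil addn0 addnA.
have v3' := esym v3.
have badV : (1 < (d a == 2) + (d b == 2) + (d c == 2)) ==> bad v.
  apply/implyP => n2; rewrite /bad v3' eqxx /=; apply: leq_trans n2 _.
  rewrite -sum1_card big_mkcond /= -[leqLHS](sumN (fun w => d w == 2 : nat)) big_mkcond /= leq_sum // => w _.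
  by rewrite inE; case: (w \in N v); case: (d w == 2).
rewrite !sumN -v3.
have := @deg3_balance (d a) (d b) (d c) (bad a) (bad b) (bad c) (bad v).
rewrite !deg_gt1 ?(N_A av) ?(N_A bv) ?(N_A cv) // => /(_ isT).
have bad3 w : bad w ==> (d w == 3) by apply/implyP => /andP[].
rewrite !bad3 => /(_ isT).
have b2 p q : p \in N v -> q \in N v -> d p == 2 -> ~~ bad q.
  by move=> pv qv /eqP; apply: bad_next_to_2 vA v3' pv qv.
have b2' p q r : p \in N v -> q \in N v -> r \in N v -> (d p == 2) ==> ~~ bad q && ~~ bad r.
  by move=> pv qv rv; apply/implyP => p2; apply/andP; split; apply: (b2 p).
rewrite !b2' // => /(_ isT).
have bb p q r : p \in N v -> q \in N v -> r \in N v -> p != q -> p != r -> q != r ->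
    bad p && bad q ==> (3 < d r).
  by move=> pv qv rv pq pr qr; apply/implyP => /andP[bp bq]; exact: (two_bad_nbrs vA v3' pv qv rv).
have [ba ca cb] : [/\ b != a, c != a & c != b] by rewrite ![_ == a]eq_sym [c == b]eq_sym.
rewrite !bb // => /(_ isT).
rewrite (three_nbrs_not_2 vA v3' av bv cv) // badV => /(_ isT isT).
by rewrite /gives v3' /=; clear; lia.
Qed.

Lemma discharging : 8 * #|A| <= 3 * \sum_(v in A) d v.
Proof.
have : \sum_(v in A) (8 + \sum_(w in N v) gives v w) <=
       \sum_(v in A) (3 * d v + \sum_(w in N v) gives w v).
  by apply: leq_sum => v; exact: charge_ge0.
have -> : \sum_(v in A) (3 * d v + \sum_(w in N v) gives w v) =
    3 * \sum_(v in A) d v + \sum_(v in A) \sum_(w in N v) gives w v.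
  by rewrite big_split big_distrr.
rewrite big_split /= sum_nat_const.
(* Total charge received equals total charge sent. *)
have -> : \sum_(v in A) \sum_(w in N v) gives w v = \sum_(v in A) \sum_(w in N v) gives v w.
  rewrite (exchange_big_dep [in A]) /=; last by move=> v w _; exact: N_A.
  apply: eq_bigr => v vA; apply: eq_bigl => w.
  by rewrite !mem_nbrs vA adjC.
by rewrite leq_add2r mulnC.
Qed.

End Discharging.

(** * Lattice walks *)

Import Order.TTheory GRing.Theory Num.Theory.

Notation lpoint := (int * int)%type.

Section Lattice.
Local Open Scope ring_scope.
Implicit Types (p q a b c : lpoint).

Definition hstep p q : bool :=
  (p.2 == q.2) && ((q.1 == p.1 + 1) || (p.1 == q.1 + 1)).
Definition vstep p q : bool :=
  (p.1 == q.1) && ((q.2 == p.2 + 1) || (p.2 == q.2 + 1)).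
Definition ladj p q : bool := hstep p q || vstep p q.

Definition lower_left p q : lpoint := (Num.min p.1 q.1, Num.min p.2 q.2).

(* A unit square (cell) is named by its lower left corner; the two cells below
   are those on both sides of the step from p to q. *)
Definition cell1 p q : lpoint := lower_left p q.
Definition cell2 p q : lpoint :=
  if hstep p q then ((lower_left p q).1, (lower_left p q).2 - 1)
  else ((lower_left p q).1 - 1, (lower_left p q).2).

(** The ray goes straight up from the centre of the cell [c], so it meets only horizontal steps over
    that column. *)
Definition crosses_ray c (d : lpoint * lpoint) : bool :=
  [&& hstep d.1 d.2, (lower_left d.1 d.2).1 == c.1 & c.2 < d.1.2].

Definition same_edge (d d' : lpoint * lpoint) : bool :=
  (d == d') || (d == (d'.2, d'.1)).

Definition above c p : bool := (p.1 == c.1) && (c.2 < p.2).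

Lemma cell1C p q : cell1 p q = cell1 q p.
Proof. by rewrite /cell1 /lower_left /= minC [Num.min p.2 _]minC. Qed.

Lemma hstepC p q : hstep p q = hstep q p.
Proof. by rewrite /hstep eq_sym orbC. Qed.

Lemma cell2C p q : cell2 p q = cell2 q p.
Proof. by rewrite /cell2 hstepC /lower_left /= minC [Num.min p.2 _]minC. Qed.

Lemma ladjC p q : ladj p q = ladj q p.
Proof. by rewrite /ladj hstepC /vstep [p.1 == _]eq_sym [(q.2 == _) || _]orbC. Qed.

Lemma ladj_irr p : ladj p p = false.
Proof. by rewrite /ladj /hstep /vstep; lia. Qed.

Definition nbrs4 p : seq lpoint :=
  [:: (p.1 + 1, p.2); (p.1 - 1, p.2); (p.1, p.2 + 1); (p.1, p.2 - 1)].

Lemma nbrs4_uniq p : uniq (nbrs4 p).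
Proof. by rewrite /= !inE !xpair_eqE; lia. Qed.

Lemma mem_nbrs4 p q : (q \in nbrs4 p) = ladj p q.
Proof.
case: p q => [px py] [qx qy].
by rewrite !inE !xpair_eqE /ladj /hstep /vstep /=; lia.
Qed.

(** A normal form of a lattice edge with its two cells, leaving only linear arithmetic to the case
    analysis. *)
Lemma nbrs4_cell p q : q \in nbrs4 p ->
  (exists u v : int, [/\ hstep p q, vstep p q = false,
     (p, q) = ((u, v), (u + 1, v)) \/ (p, q) = ((u + 1, v), (u, v)),
     cell1 p q = (u, v) & cell2 p q = (u, v - 1)]) \/
  (exists u v : int, [/\ hstep p q = false, vstep p q,
     (p, q) = ((u, v), (u, v + 1)) \/ (p, q) = ((u, v + 1), (u, v)),
     cell1 p q = (u, v) & cell2 p q = (u - 1, v)]).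
Proof.
case: p => x y; rewrite !inE => /or4P[] /eqP-> /=.
- left; exists x, y; have hs : hstep (x, y) (x + 1, y) by rewrite /hstep /=; lia.
  rewrite hs /cell2 hs /cell1 /lower_left /vstep /=; split=> //; try lia; first by left.
    by congr pair; lia.
  by congr pair; lia.
- left; exists (x - 1), y; have hs : hstep (x, y) (x - 1, y) by rewrite /hstep /=; lia.
  rewrite hs /cell2 hs /cell1 /lower_left /vstep /=; split=> //; try lia; first by right; rewrite subrK.
    by congr pair; lia.
  by congr pair; lia.
- right; exists x, y; have hs : hstep (x, y) (x, y + 1) = false by rewrite /hstep /=; lia.
  rewrite hs /cell2 hs /cell1 /lower_left /vstep /=; split=> //; try lia; first by left.
    by congr pair; lia.
  by congr pair; lia.
- right; exists x, (y - 1); have hs : hstep (x, y) (x, y - 1) = false by rewrite /hstep /=; lia.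
  rewrite hs /cell2 hs /cell1 /lower_left /vstep /=; split=> //; try lia; first by right; rewrite subrK.
    by congr pair; lia.
  by congr pair; lia.
Qed.

(** Across a horizontal edge, the lower ray meets just that edge in addition. Across a vertical
    edge, the rays run on both sides of the half-line above it: exactly one of them is crossed when
    [d] is horizontal with one end on that half-line, and the only vertical step with one end on it
    is the edge itself. *)
Lemma crosses_ray_cells p q d : ladj p q -> ladj d.1 d.2 ->
  crosses_ray (cell1 p q) d (+) crosses_ray (cell2 p q) d =
  same_edge (p, q) d (+)
  (vstep p q && (above (cell1 p q) d.1 (+) above (cell1 p q) d.2)).
Proof.
case: d => a b /=; rewrite -!mem_nbrs4.
move=> /nbrs4_cell[] [x [y [hp vp pq c1 c2]]] /nbrs4_cell[] [u [v [ha va ab d1 d2]]];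
  rewrite /crosses_ray /above c1 c2 vp -[lower_left (a, b).1 (a, b).2]/(cell1 a b) d1 [hstep _ _]ha /=.
- have -> : a.2 = v by case: ab => -[-> _].
  case: ab pq => -[-> ->] [] [-> ->]; rewrite /same_edge !xpair_eqE /=; lia.
- case: ab pq => -[-> ->] [] [-> ->]; rewrite /same_edge !xpair_eqE /=; lia.
- have -> : a.2 = v by case: ab => -[-> _].
  case: ab pq => -[-> ->] [] [-> ->]; rewrite /same_edge !xpair_eqE /=; lia.
- case: ab pq => -[-> ->] [] [-> ->]; rewrite /same_edge !xpair_eqE /=; lia.
Qed.

(** Going around [p], each of the four cells is met by two of the four edges. *)
Lemma coboundary_nbrs4 (c : lpoint -> bool) p :
  \big[addb/false]_(q <- nbrs4 p) (c (cell1 p q) (+) c (cell2 p q)) = false.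
Proof.
case: p => x y; rewrite /nbrs4 !big_cons big_nil /=.
have -> : cell1 (x, y) (x + 1, y) = (x, y) by rewrite /cell1 /lower_left /=; congr pair; lia.
have -> : cell2 (x, y) (x + 1, y) = (x, y - 1).
  by rewrite /cell2 /hstep /lower_left /= !eqxx /=; congr pair; lia.
have -> : cell1 (x, y) (x - 1, y) = (x - 1, y) by rewrite /cell1 /lower_left /=; congr pair; lia.
have -> : cell2 (x, y) (x - 1, y) = (x - 1, y - 1).
  have hs : hstep (x, y) (x - 1, y) by rewrite /hstep /=; lia.
  by rewrite /cell2 hs /lower_left /=; congr pair; lia.
have -> : cell1 (x, y) (x, y + 1) = (x, y) by rewrite /cell1 /lower_left /=; congr pair; lia.
have -> : cell2 (x, y) (x, y + 1) = (x - 1, y).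
  have hs : hstep (x, y) (x, y + 1) = false by rewrite /hstep /=; lia.
  by rewrite /cell2 hs /lower_left /=; congr pair; lia.
have -> : cell1 (x, y) (x, y - 1) = (x, y - 1) by rewrite /cell1 /lower_left /=; congr pair; lia.
have -> : cell2 (x, y) (x, y - 1) = (x - 1, y - 1).
  have hs : hstep (x, y) (x, y - 1) = false by rewrite /hstep /=; lia.
  by rewrite /cell2 hs /lower_left /=; congr pair; lia.
by do 4!case: (c _).
Qed.

End Lattice.

(** * Faces cut out by a family of lattice routes *)

Lemma addb_sum_sym (T : Type) (g : T -> T -> bool) (P : pred T) (X : seq T) :
  (forall p q, g p q = g q p) -> (forall p, g p p = false) ->
  \big[addb/false]_(p <- X | P p) \big[addb/false]_(q <- X | P q) g p q = false.
Proof.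
move=> gC g0; rewrite -big_filter; under eq_bigr do rewrite -big_filter.
elim: {X}(filter P X) => [|x X IHX]; first by rewrite big_nil.
under eq_bigr do rewrite big_cons.
rewrite big_cons g0 addFb big_split /= IHX addbF -big_split /= big1 // => p _.
by rewrite gC addbb.
Qed.

Definition steps (T : Type) (p : T) (w : seq T) : seq (T * T) := pairmap pair p w.

Lemma steps_cat (T : Type) (p : T) (w1 w2 : seq T) :
  steps p (w1 ++ w2) = steps p w1 ++ steps (last p w1) w2.
Proof. exact: pairmap_cat. Qed.

Lemma mem_steps (T : eqType) (p : T) w d :
  d \in steps p w -> d.1 \in p :: w /\ d.2 \in w.
Proof.
elim: w p => [|q w IHw] p //; rewrite -[steps _ _]/((p, q) :: steps q w).
rewrite [d \in _]inE => /predU1P[->|/IHw[d1 d2]].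
  by rewrite /= !inE !eqxx.
by rewrite in_cons d1 in_cons d2 !orbT.
Qed.

Lemma path_steps (T : eqType) (e : rel T) (p : T) w d :
  path e p w -> d \in steps p w -> e d.1 d.2.
Proof.
elim: w p => [|q w IHw] p //= /andP[pq qw]; rewrite inE.
by case/predU1P=> [->|/(IHw _ qw)].
Qed.

Lemma addb_sum_steps (T : eqType) (f : T -> bool) (p : T) w :
  \big[addb/false]_(d <- steps p w) (f d.1 (+) f d.2) = f p (+) f (last p w).
Proof.
elim: w p => [|q w IHw] p /=; first by rewrite big_nil addbb.
by rewrite big_cons IHw /= -addbA addKb.
Qed.

Lemma addb_sum_has (I : eqType) (X : seq I) (P b : pred I) :
  \big[addb/false]_(i <- X | P i) b i -> exists i, [/\ i \in X, P i & b i].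
Proof.
have [/hasP[i iX /andP[Pi bi]] _|/hasPn H] := boolP (has (predI P b) X); first by exists i.
rewrite big_seq_cond big1 // => i /andP[/H /=]; rewrite negb_and => /orP[/negPf->//|/negPf->//].
Qed.

Section GridDual.
Variables (V E : finType) (s t : E -> V).
Variables (beta : lpoint -> V + E) (root : V -> lpoint).
Variables (w1 : E -> seq lpoint) (m : E -> lpoint) (w2 : E -> seq lpoint).
Variables (q : E -> lpoint) (w3 : E -> seq lpoint).

(** Under [beta] the three stretches carry the labels [s e], [e] and [t e], so the label changes at
    exactly two steps. Routes may overlap where they carry the same vertex label. *)
Definition route e := w1 e ++ (m e :: w2 e) ++ (q e :: w3 e).

Hypothesis st : forall e, s e != t e.
Hypothesis route_path : forall e, path ladj (root (s e)) (route e).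
Hypothesis route_last : forall e, last (root (s e)) (route e) = root (t e).
Hypothesis beta1 : forall e p, p \in root (s e) :: w1 e -> beta p = inl (s e).
Hypothesis beta2 : forall e p, p \in m e :: w2 e -> beta p = inr e.
Hypothesis beta3 : forall e p, p \in q e :: w3 e -> beta p = inl (t e).

Let esteps e := steps (root (s e)) (route e).
Let l e := last (root (s e)) (w1 e).

Lemma esteps_cases e d : d \in esteps e ->
  [\/ beta d.1 = beta d.2, d = (l e, m e) | d = (last (m e) (w2 e), q e)].
Proof.
rewrite /esteps /route !steps_cat /= !mem_cat !inE !mem_cat !inE.
case/or4P=> [|||/orP[]].
- by case/mem_steps=> d1 d2; constructor 1; rewrite !(@beta1 e) // inE d2 orbT.
- by move/eqP; constructor 2.
- by case/mem_steps=> d1 d2; constructor 1; rewrite !(@beta2 e) // inE d2 orbT.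
- by move/eqP; constructor 3.
- by case/mem_steps=> d1 d2; constructor 1; rewrite !(@beta3 e) // inE d2 orbT.
Qed.

Lemma beta_l e : beta (l e) = inl (s e).
Proof. by apply: beta1; rewrite mem_last. Qed.

Lemma beta_m e : beta (m e) = inr e.
Proof. by apply: beta2; rewrite mem_head. Qed.

Lemma beta_last2 e : beta (last (m e) (w2 e)) = inr e.
Proof. by apply: beta2; rewrite mem_last. Qed.

Lemma beta_q e : beta (q e) = inl (t e).
Proof. by apply: beta3; rewrite mem_head. Qed.

Lemma esteps_lm e : (l e, m e) \in esteps e.
Proof. by rewrite /esteps /route !steps_cat /= mem_cat inE eqxx orbT. Qed.

Lemma ladj_esteps e d : d \in esteps e -> ladj d.1 d.2.
Proof. exact: path_steps. Qed.

Definition ray_parity (z : {set E}) (c : lpoint) : bool :=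
  \big[addb/false]_(e in z) \big[addb/false]_(d <- esteps e) crosses_ray c d.

(* Across a vertical lattice edge the two vertical rays differ by the number of
   steps leaving the open half-line above the edge, which is even along the
   closed walks that an even edge set decomposes into. *)
Lemma ray_parity_step (z : {set E}) a b : even_set s t z -> ladj a b ->
  ray_parity z (cell1 a b) (+) ray_parity z (cell2 a b) =
  \big[addb/false]_(e in z) \big[addb/false]_(d <- esteps e) same_edge (a, b) d.
Proof.
move=> /forallP even_z ab; rewrite /ray_parity -big_split /=.
under eq_bigr do rewrite -big_split /=.
pose T := above (cell1 a b).
have v0 : \big[addb/false]_(e in z) \big[addb/false]_(d <- esteps e)
             (vstep a b && (T d.1 (+) T d.2)) = false.
  have distr (I : Type) (r : seq I) (P f : pred I) :
      \big[addb/false]_(i <- r | P i) (vstep a b && f i) =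
      vstep a b && \big[addb/false]_(i <- r | P i) f i.
    by rewrite big_distrr.
  under eq_bigr do rewrite distr addb_sum_steps route_last.
  rewrite distr.
  suff -> : \big[addb/false]_(e in z) (T (root (s e)) (+) T (root (t e))) = false.
    by rewrite andbF.
  (* Regrouping the ends of the routes by vertex makes the boundary of [z] appear. *)
  transitivity (\big[addb/false]_v (bdry s t z v && T (root v))); last first.
    by rewrite big1 // => v _; rewrite (negPf (even_z v)).
  under [RHS]eq_bigr do rewrite /bdry big_distrl /=.
  rewrite exchange_big /=; apply: eq_bigr => e _.
  rewrite (bigD1 (s e)) // (bigD1 (t e)) /=; last by rewrite eq_sym.
  rewrite big1 ?addbF.
    by rewrite /inc !eqxx [t e == s e]eq_sym (negPf (st e)).
  by move=> v /andP[]; rewrite /inc ![v == _]eq_sym => /negPf-> /negPf->.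
have addb0 (x y : bool) : y = false -> x = x (+) y by move=> ->; rewrite addbF.
rewrite [RHS](addb0 _ _ v0) -big_split; apply: eq_bigr => e _ /=.
rewrite -big_split /= !big_seq; apply: eq_bigr => d /ladj_esteps dd.
by rewrite crosses_ray_cells.
Qed.

(* Two cells are in the same face when no even edge set separates them, which
   avoids any reference to connected components. *)
Definition cell_face (c : lpoint) : {ffun {set E} -> bool} :=
  [ffun z => even_set s t z && ray_parity z c].

(** The sides of [e] are read at a single step, the one where the route leaves the label of its
    source. *)
Definition face1 e := cell_face (cell1 (l e) (m e)).
Definition face2 e := cell_face (cell2 (l e) (m e)).

Lemma ladj_lm e : ladj (l e) (m e).
Proof. exact: ladj_esteps (esteps_lm e). Qed.

(** The labels at the two ends of this step identify [e], and [s e != t e] distinguishes it from the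
    other label change of the same route. *)
Lemma sum_same_edge e e' :
  \big[addb/false]_(d <- esteps e') same_edge (l e, m e) d = (e' == e).
Proof.
have off : forall d, d \in esteps e' -> same_edge (l e, m e) d ->
    e' = e /\ d = (l e, m e).
  case=> d1 d2 /esteps_cases + /orP[]; rewrite !xpair_eqE /= => + /andP[/eqP e1 /eqP e2];
    rewrite -e1 -e2 beta_l beta_m; case=> // -[/(congr1 beta) h1 /(congr1 beta)].
  - by move: h1; rewrite !beta_l !beta_m => _ [->].
  - by move: h1; rewrite beta_l beta_last2.
  - by move: h1; rewrite beta_l beta_m.
  move: h1; rewrite beta_m beta_last2 beta_l beta_q => -[->] [] /eqP.
  by rewrite (negPf (st _)).
have [->|ne] := eqVneq e' e; last first.
  rewrite big_seq big1 // => d de; apply/negP => /(off d de)[ee'].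
  by rewrite ee' eqxx in ne.
have bl := beta_l e; have bm := beta_m e; have bl2 := beta_last2 e; have bq := beta_q e.
have zero (r : seq (lpoint * lpoint)) : (forall d, d \in r -> beta d.1 = beta d.2) ->
    \big[addb/false]_(d <- r) same_edge (l e, m e) d = false.
  move=> H; rewrite big_seq big1 // => -[d1 d2] /H /= bd.
  by apply/negP=> /orP[]; rewrite xpair_eqE /= => /andP[/eqP e1 /eqP e2];
     move: bl bm; rewrite e1 e2 bd => -> .
rewrite /esteps /route !steps_cat /= !(big_cat, big_cons) /= !zero.
- rewrite /same_edge eqxx /= !xpair_eqE.
  have -> : (l e == last (m e) (w2 e)) = false.
    by apply/eqP => /(congr1 beta); rewrite bl bl2.
  have -> : (l e == q e) && (m e == last (m e) (w2 e)) = false.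
    apply/negP => /andP[/eqP/(congr1 beta)]; rewrite bl bq => -[] /eqP; rewrite ?andbT.
    by rewrite (negPf (st e)).
  by [].
- by move=> d /mem_steps[d1 d2]; rewrite !(@beta3 e) // inE d2 orbT.
- by move=> d /mem_steps[d1 d2]; rewrite !(@beta2 e) // inE d2 orbT.
- by move=> d /mem_steps[d1 d2]; rewrite !(@beta1 e) // inE d2 orbT.
Qed.

(** Take the faces on which the ray parity of [z] is odd: across the step chosen for [e] this parity
    changes exactly when [e] is in [z]. *)
Lemma even_set_face (z : {set E}) :
  even_set s t z -> exists phi, z = face_bdry face1 face2 phi.
Proof.
move=> even_z; exists [set f : {ffun {set E} -> bool} | f z]; apply/setP=> e.
rewrite !inE !ffunE even_z /= ray_parity_step ?ladj_lm //.
under eq_bigr do rewrite sum_same_edge.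
have [ez|ez] := boolP (e \in z); last first.
  by rewrite big1 // => e' e'z; apply: contraNF ez => /eqP <-.
by rewrite (bigD1 e) //= eqxx big1 // => e' /andP[_ /negPf].
Qed.

Section FaceEven.
Variable f : {ffun {set E} -> bool}.

Let side (c : lpoint) := cell_face c == f.
Let g a b := ladj a b && (side (cell1 a b) (+) side (cell2 a b)).

Lemma gC a b : g a b = g b a.
Proof. by rewrite /g ladjC cell1C cell2C. Qed.

Lemma g_irr a : g a a = false.
Proof. by rewrite /g ladj_irr. Qed.

(** Across a lattice edge that no route uses, no ray parity changes, so both cells belong to the
    same face. *)
Lemma g_esteps a b : g a b -> exists e d, d \in esteps e /\ same_edge (a, b) d.
Proof.
case/andP=> ab sides.
have [/existsP[e /hasP[d de sd]]|] := boolP [exists e, has (same_edge (a, b)) (esteps e)].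
  by exists e, d.
rewrite negb_exists => /forallP unused; move: sides; rewrite /side.
have -> : cell_face (cell1 a b) = cell_face (cell2 a b); last by rewrite addbb.
apply/ffunP=> z; rewrite !ffunE; case: (boolP (even_set s t z)) => //= even_z.
have := ray_parity_step even_z ab; rewrite big1; first by do 2!case: (ray_parity _ _).
move=> e _; rewrite big_seq big1 // => d de; apply: contraNF (unused e) => sd.
by apply/hasP; exists d.
Qed.

Let Y : seq lpoint := undup (flatten [seq root (s e) :: route e | e <- enum E]).

Lemma g_mem a b : g a b -> b \in Y.
Proof.
case/g_esteps=> e [[d1 d2] [/mem_steps/= [m1 m2] sd]].
rewrite mem_undup; apply/flattenP; exists (root (s e) :: route e).
  by apply: map_f; rewrite mem_enum.
case/orP: sd; rewrite xpair_eqE => /andP[_ /eqP->] //=.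
by rewrite inE m2 orbT.
Qed.

Lemma g_row a : \big[addb/false]_(b <- Y) g a b = false.
Proof.
transitivity (\big[addb/false]_(b <- nbrs4 a) g a b); last first.
  rewrite -[RHS](coboundary_nbrs4 side a) !big_seq.
  by apply: eq_bigr => b; rewrite mem_nbrs4 /g => ->.
have keep r : \big[addb/false]_(b <- r) g a b = \big[addb/false]_(b <- filter (g a) r) g a b.
  by rewrite big_filter [RHS]big_mkcond; apply: eq_bigr => b _; case: (g a b).
rewrite (keep Y) (keep (nbrs4 a)); apply: perm_big.
apply: uniq_perm; rewrite ?filter_uniq ?undup_uniq ?nbrs4_uniq // => b.
rewrite !mem_filter; case gab: (g a b) => //=.
by rewrite (g_mem gab) mem_nbrs4; case/andP: gab.
Qed.

(** Contracting all points with the same label turns the lattice boundary of the face [f] into a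
    symmetric matrix modulo 2 with zero diagonal and zero row sums. *)
Let D X X' := \big[addb/false]_(a <- Y | beta a == X)
  \big[addb/false]_(b <- Y | beta b == X') g a b.

Lemma DC X X' : D X X' = D X' X.
Proof.
rewrite /D exchange_big /=; apply: eq_bigr => a _; apply: eq_bigr => b _; exact: gC.
Qed.

Lemma D_row X : \big[addb/false]_X' D X X' = false.
Proof.
rewrite /D exchange_big big1 //= => a _.
under eq_bigr do rewrite big_mkcond.
rewrite exchange_big /= -[RHS](g_row a); apply: eq_bigr => b _.
by rewrite (bigD1 (beta b)) //= eqxx big1 ?addbF // => X'; rewrite eq_sym => /negPf->.
Qed.

Lemma D_irr X : D X X = false.
Proof. by apply: addb_sum_sym => [a b|a]; [exact: gC | exact: g_irr]. Qed.

Lemma D_witness X X' : D X X' -> X != X' -> exists a b e,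
  [/\ beta a = X, beta b = X', g a b &
      [\/ (a, b) = (l e, m e), (a, b) = (m e, l e),
          (a, b) = (last (m e) (w2 e), q e) | (a, b) = (q e, last (m e) (w2 e))]].
Proof.
case/addb_sum_has=> a [_ /eqP aX /addb_sum_has[b [_ /eqP bX' gab]]] XX'.
have [e [[d1 d2] [/esteps_cases de sd]]] := g_esteps gab.
exists a, b, e; split=> //.
case/orP: sd => /eqP[e1 e2]; case: de; rewrite -?e1 -?e2 => H.
- by rewrite /= aX bX' in H; rewrite H eqxx in XX'.
- by constructor 1.
- by constructor 3.
- by rewrite /= aX bX' in H; rewrite H eqxx in XX'.
- by constructor 2; case: H => -> ->.
- by constructor 4; case: H => -> ->.
Qed.

Lemma D_vertices v w : D (inl v) (inl w) = false.
Proof.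
have [->|vw] := eqVneq v w; first exact: D_irr.
apply/negP => /D_witness[|a [b [e [av bw _]]]]; first by apply: contraNneq vw => -[->].
case=> -[ea eb]; move: av bw; rewrite ea eb ?beta_l ?beta_m ?beta_last2 ?beta_q //.
Qed.

Lemma D_edges e e' : D (inr e) (inr e') = false.
Proof.
have [->|vw] := eqVneq e e'; first exact: D_irr.
apply/negP => /D_witness[|a [b [e'' [av bw _]]]]; first by apply: contraNneq vw => -[->].
case=> -[ea eb]; move: av bw; rewrite ea eb ?beta_l ?beta_m ?beta_last2 ?beta_q //.
Qed.

Lemma D_source e : D (inr e) (inl (s e)) = g (l e) (m e).
Proof.
have key a b : beta a = inr e -> beta b = inl (s e) -> g a b -> a = m e /\ b = l e.
  move=> ae be gab; have [e' [[d1 d2] [/esteps_cases de sd]]] := g_esteps gab.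
  case/orP: sd => /eqP[e1 e2]; case: de; rewrite -?e1 -?e2 /= ?ae ?be => H //.
  - by case: H => ea _; rewrite ea beta_l in ae.
  - case: H => ea eb; move: ae be; rewrite ea eb beta_last2 beta_q => -[->] [] /eqP.
    by rewrite eq_sym (negPf (st e)).
  - by case: H => eb ea; move: ae; rewrite ea eb beta_m => -[->].
  - by case: H => eb ea; move: ae; rewrite ea beta_q.
rewrite /D; case glm: (g (l e) (m e)); last first.
  rewrite big1 // => a /eqP ae; rewrite big1 // => b /eqP be.
  by apply: contraFF glm => gab; have [<- <-] := key a b ae be gab; rewrite gC.
have gml : g (m e) (l e) by rewrite gC.
rewrite big_mkcond (bigD1_seq (m e)) ?undup_uniq ?(g_mem glm) //= beta_m eqxx.
rewrite big_mkcond (bigD1_seq (l e)) ?undup_uniq ?(g_mem gml) //= beta_l eqxx gml.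
rewrite !big1 // => [a am|b bl].
  case: eqP => // ae; rewrite big1 // => b /eqP be.
  by apply: contraNF am => gab; have [->] := key a b ae be gab.
case: eqP => // be; apply: contraNF bl => gab.
by have [_ ->] := key _ _ (beta_m e) be gab.
Qed.

Lemma D_other e v : v != s e -> v != t e -> D (inr e) (inl v) = false.
Proof.
move=> vs vt; apply/negP => /D_witness[//|a [b [e' [ae bv _ H]]]].
by case: H ae bv => -[-> ->]; rewrite ?beta_l ?beta_m ?beta_last2 ?beta_q // => -[->] [] /eqP;
  rewrite eq_sym ?(negPf vs) ?(negPf vt).
Qed.

(** The stretch labelled [e] has exits only towards [s e] and [t e]. As its row sums to zero, both
    exits have the same parity, so faces need not be followed along the route. *)
Lemma D_inc e v : D (inr e) (inl v) = inc s t e v && g (l e) (m e).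
Proof.
have [->|vs] := eqVneq v (s e).
  by rewrite D_source /inc eqxx [t e == _]eq_sym (negPf (st e)).
have [->|vt] := eqVneq v (t e); last first.
  by rewrite D_other // /inc ![_ == v]eq_sym (negPf vs) (negPf vt).
have := D_row (inr e); rewrite big_sumType /= [X in _ (+) X]big1; last by move=> e' _; exact: D_edges.
rewrite addbF (bigD1 (s e)) // (bigD1 (t e)) /=; last by rewrite eq_sym.
rewrite [X in _ (+) (_ (+) X)]big1; last by move=> w /andP[]; exact: D_other.
by rewrite addbF D_source /inc eqxx (negPf (st e)) /=; case: (g _ _); case: (D _ _).
Qed.

(** By [D_inc], this boundary is the row sum of [D] at [v]. *)
Lemma face_even v : bdry s t (face_bdry face1 face2 [set f]) v = false.
Proof.
rewrite -[RHS](D_row (inl v)) big_sumType /= [X in X (+) _]big1 => [|w _]; last exact: D_vertices.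
rewrite addFb /bdry big_mkcond /=; apply: eq_bigr => e _.
rewrite DC D_inc !inE /g ladj_lm /= /side andbC; by case: ifP.
Qed.

End FaceEven.

Lemma grid_dual : exists (F : finType) (f1 f2 : E -> F),
  (forall f, even_set s t (face_bdry f1 f2 [set f])) /\
  (forall z, even_set s t z -> exists phi, z = face_bdry f1 f2 phi).
Proof.
exists {ffun {set E} -> bool}, face1, face2; split=> [f|]; last exact: even_set_face.
by apply/forallP => v; rewrite face_even.
Qed.

End GridDual.

(** * Squares around the vertices and routes between them *)

Lemma split_last (T : Type) (a : pred T) (u : seq T) :
  has a u -> exists s1 y s2, [/\ u = s1 ++ y :: s2, a y & all (predC a) s2].
Proof.
elim: u => //= x u IHu; have [hu _|hu] := boolP (has a u).
  have [s1 [y [s2 [-> ay s2a]]]] := IHu hu.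
  by exists (x :: s1), y, s2.
by rewrite orbF => ax; exists [::], x, u; split=> //; rewrite all_predC.
Qed.

Lemma split_first (T : Type) (b : pred T) (u : seq T) :
  has b u -> exists s1 z s2, [/\ u = s1 ++ z :: s2, b z & all (predC b) s1].
Proof.
elim: u => //= x u IHu; have [bx _|bx /= /IHu[s1 [z [s2 [-> bz s1b]]]]] := boolP (b x).
  by exists [::], x, u.
by exists (x :: s1), z, s2; rewrite /= bx.
Qed.

(** Between the first [b]-point and the last [a]-point preceding it, neither predicate holds. *)
Lemma split_crossing (T : Type) (a b : pred T) (x : T) (s : seq T) :
  (forall y, a y -> ~~ b y) -> a x -> b (last x s) ->
  exists s1 y s2 z s3,
    [/\ x :: s = s1 ++ y :: s2 ++ z :: s3, a y, b z, all (predC a) s2 & all (predC b) s2].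
Proof.
move=> ab ax bs; have hb : has b (x :: s).
  by rewrite lastI has_rcons bs.
have [u [z [s3 [xs bz ub]]]] := split_first hb.
have : has a u by case: u xs {ub} => [[xz _]|y u [<- _]] /=; rewrite ?ax // -xz (negPf (ab _ ax)) in bz *.
move=> /split_last[s1 [y [s2 [us ay s2a]]]].
exists s1, y, s2, z, s3; split=> //; first by rewrite xs us -catA.
by move: ub; rewrite us all_cat /= => /and3P[].
Qed.

Section Squares.
Local Open Scope ring_scope.

Lemma monotone_walk (c p : lpoint) : exists w,
  [/\ path ladj c w, last c w = p &
      forall x, x \in w ->
        [/\ Num.min c.1 p.1 <= x.1, x.1 <= Num.max c.1 p.1,
            Num.min c.2 p.2 <= x.2 & x.2 <= Num.max c.2 p.2]].
Proof.
have [n] := ubnP (`|c.1 - p.1| + `|c.2 - p.2|)%N.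
elim: n c => // n IHn [x y]; case: p IHn => x' y' /= IHn lt_n.
have [xx'|xx'] := eqVneq x x'.
  subst x'.
  have [<-|yy'] := eqVneq y y'; first by exists [::].
  pose y1 := if y < y' then y + 1 else y - 1.
  have [|w [pw lw box]] := IHn (x, y1); first by rewrite /= /y1; move: lt_n yy'; case: ifP; lia.
  exists ((x, y1) :: w); split=> //=.
    by rewrite pw andbT /ladj /hstep /vstep /= /y1; case: ifP; lia.
  move=> q; rewrite inE => /predU1P[->/=|/box/=[b1 b2 b3 b4]].
    by move: yy'; rewrite /y1; case: ifP => *; split; lia.
  by move: yy' b3 b4; rewrite /y1; case: ifP => *; split; lia.
pose x1 := if x < x' then x + 1 else x - 1.
have [|w [pw lw box]] := IHn (x1, y); first by rewrite /= /x1; move: lt_n xx'; case: ifP; lia.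
exists ((x1, y) :: w); split=> //=.
  by rewrite pw andbT /ladj /hstep /vstep /= /x1; case: ifP; lia.
move=> q; rewrite inE => /predU1P[->/=|/box/=[b1 b2 b3 b4]].
  by move: xx'; rewrite /x1; case: ifP => *; split; lia.
by move: xx' b1 b2; rewrite /x1; case: ifP => *; split; lia.
Qed.

Definition in_square (K : int) (c p : lpoint) : bool :=
  (`|p.1 - c.1| <= K) && (`|p.2 - c.2| <= K).

Lemma walk_in_square K c p p' : in_square K c p -> in_square K c p' ->
  exists w, [/\ path ladj p w, last p w = p' & all (in_square K c) (p :: w)].
Proof.
move=> cp cp'; have [w [pw lw box]] := monotone_walk p p'.
exists w; split=> //=; rewrite cp; apply/allP => q /box[].
by case: c p p' q cp cp' {pw lw box} => [? ?] [? ?] [? ?] [? ?]; rewrite /in_square /=; lia.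
Qed.

End Squares.

Section SquaresAndWalks.
Local Open Scope ring_scope.
Variables (V E : finType) (s t : E -> V) (o : V -> lpoint) (K : int) (A : E -> seq lpoint).
Hypothesis K0 : 0 <= K.
Hypothesis st : forall e, s e != t e.
Hypothesis A_path : forall e, path ladj (o (s e)) (A e).
Hypothesis A_last : forall e, last (o (s e)) (A e) = o (t e).
Hypothesis far_centers : forall u v, u != v -> ~~ in_square (K + K + 1) (o u) (o v).
Hypothesis far_walks : forall e w p, w != s e -> w != t e -> p \in o (s e) :: A e ->
  ~~ in_square K (o w) p.
Hypothesis disjoint_walks : forall e e' p, p \in o (s e) :: A e -> p \in o (s e') :: A e' ->
  (forall w, ~~ in_square K (o w) p) -> e = e'.

Lemma squares_disjoint u v p : in_square K (o u) p -> in_square K (o v) p -> u = v.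
Proof.
move=> up vp; apply/eqP; apply: contraT => /far_centers.
by move: up vp; rewrite /in_square; lia.
Qed.

(** Here the [+ 1] in [far_centers] is used: one lattice step cannot join two squares. *)
Lemma squares_not_adjacent u v p p' :
  in_square K (o u) p -> in_square K (o v) p' -> ladj p p' -> u = v.
Proof.
move=> up vp pp'; apply/eqP; apply: contraT => /far_centers.
by move: up vp pp'; rewrite /in_square /ladj /hstep /vstep; lia.
Qed.

(** The walk may leave and re-enter its end squares. Only a stretch from the source square to the
    target square with interior outside both is kept, and it is joined to the centres inside the
    squares. *)
Lemma route_exists e : exists r : (seq lpoint * lpoint) * (seq lpoint * lpoint) * seq lpoint,
  let: ((w1, m), (w2, q), w3) := r in
  [/\ path ladj (o (s e)) (w1 ++ (m :: w2) ++ (q :: w3)),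
      last (o (s e)) (w1 ++ (m :: w2) ++ (q :: w3)) = o (t e),
      {in o (s e) :: w1, forall p, in_square K (o (s e)) p},
      {in m :: w2, forall p, p \in A e /\ forall w, ~~ in_square K (o w) p} &
      {in q :: w3, forall p, in_square K (o (t e)) p}].
Proof.
have sq0 v : in_square K (o v) (o v) by rewrite /in_square; lia.
have ab y : in_square K (o (s e)) y -> ~~ in_square K (o (t e)) y.
  by move=> sy; apply: contra (st e) => ty; rewrite (squares_disjoint sy ty).
have [|s1 [y [s2 [z [s3 [oA sy tz s2a s2b]]]]]] := split_crossing ab (sq0 (s e)) (s := A e).
  by rewrite A_last.
have : path ladj y (rcons s2 z).
  have := A_path e; case: s1 oA => [[-> ->]|x s1 [-> ->]].
    by rewrite -cat_rcons cat_path => /andP[].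
  by rewrite cat_path /= -cat_rcons cat_path => /and4P[].
have s2A p : p \in s2 -> p \in o (s e) :: A e.
  by rewrite oA !(mem_cat, inE) => ->; rewrite !orbT.
(* The middle stretch is nonempty because the two squares are not adjacent. *)
case: s2 s2A s2a s2b {oA} => [_ _ _ /= /andP[yz _]|m w2 s2A s2a s2b yz].
  by have := squares_not_adjacent sy tz yz; move/eqP; rewrite (negPf (st e)).
have [w1 [pw1 lw1 /allP sw1]] := walk_in_square (sq0 (s e)) sy.
have [w3 [pw3 lw3 /allP sw3]] := walk_in_square tz (sq0 (t e)).
exists (w1, m, (w2, z), w3); split=> //.
- rewrite cat_path pw1 lw1 -cat_rcons cat_path last_rcons pw3 andbT.
  by rewrite rcons_cons in yz.
- by rewrite !(last_cat, last_cons).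
- move=> p pm; have off w : ~~ in_square K (o w) p.
    have [->|ws] := eqVneq w (s e); first exact: (allP s2a).
    have [->|wt] := eqVneq w (t e); first exact: (allP s2b).
    by apply: (far_walks ws wt); apply: s2A.
  split=> //; have := s2A _ pm; rewrite inE => /predU1P[po|//].
  by have := off (s e); rewrite po sq0.
Qed.

Lemma squares_dual (v0 : V) : exists (F : finType) (f1 f2 : E -> F),
  (forall f, even_set s t (face_bdry f1 f2 [set f])) /\
  (forall z, even_set s t z -> exists phi, z = face_bdry f1 f2 phi).
Proof.
have [r rP] := fin_all_exists route_exists.
pose w1 e := (r e).1.1.1; pose m e := (r e).1.1.2; pose w2 e := (r e).1.2.1.
pose q e := (r e).1.2.2; pose w3 e := (r e).2.
have {}rP e : [/\ path ladj (o (s e)) (w1 e ++ (m e :: w2 e) ++ (q e :: w3 e)),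
      last (o (s e)) (w1 e ++ (m e :: w2 e) ++ (q e :: w3 e)) = o (t e),
      {in o (s e) :: w1 e, forall p, in_square K (o (s e)) p},
      {in m e :: w2 e, forall p, p \in A e /\ forall w, ~~ in_square K (o w) p} &
      {in q e :: w3 e, forall p, in_square K (o (t e)) p}].
  by have := rP e; rewrite /w1 /m /w2 /q /w3; case: (r e) => [[[? ?] [? ?]] ?].
(* Squares take precedence over walks; [inl v0] is a default for points met by neither. *)
pose beta p : V + E := if [pick v | in_square K (o v) p] is Some v then inl v else
  if [pick e | p \in m e :: w2 e] is Some e then inr e else inl v0.
have betaV v p : in_square K (o v) p -> beta p = inl v.
  rewrite /beta; case: pickP => [u up vp|/(_ v)->//].
  by rewrite (squares_disjoint up vp).
apply: (grid_dual (beta := beta) (root := o) (w1 := w1) (m := m) (w2 := w2) (q := q) (w3 := w3) st).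
- by move=> e; have [] := rP e.
- by move=> e; have [] := rP e.
- by move=> e p; have [_ _ H _ _] := rP e => /H/betaV.
- move=> e p pm; have [_ _ _ /(_ p pm)[pA off] _] := rP e.
  rewrite /beta; case: pickP => [u|_]; first by rewrite (negPf (off u)).
  case: pickP => [e' pe'|/(_ e)]; last by rewrite pm.
  have [_ _ _ /(_ p pe')[pA' _] _] := rP e'.
  by rewrite (disjoint_walks (e := e') (e' := e) (p := p)) // inE ?pA ?pA' orbT.
- by move=> e p; have [_ _ _ _ H] := rP e => /H/betaV.
Qed.

End SquaresAndWalks.

(** * From a drawing to a lattice *)

From mathcomp Require Import all_classical all_reals all_analysis.
Import numFieldNormedType.Exports.

Section Separation.
Local Open Scope classical_set_scope.
Local Open Scope ring_scope.
Variable R : realType.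
Implicit Types (X Y : set (R * R)) (g : R -> R * R).

(** The continuous distance attains a positive minimum on the product. Stating the margin for all
    small [eps] lets finitely many margins be intersected. *)
Lemma compact_separation X Y : compact X -> compact Y -> X `&` Y = set0 ->
  \forall eps \near 0^'+, forall p q, X p -> Y q -> eps <= `|p - q|.
Proof.
move=> cX cY XY0.
have [[[p0 q0] [/= Xp0 Yq0]]|XY] := pselect (X `*` Y !=set0); last first.
  by near=> eps => p q Xp Yq; exfalso; apply: XY; exists (p, q).
pose f (d : (R * R) * (R * R)) : R := `|d.1 - d.2|.
have cf : continuous f.
  by move=> d; apply: cvg_norm; apply: cvgB; [exact: cvg_fst|exact: cvg_snd].
have [||[p q]] := @compact_EVT_min _ _ f (X `*` Y) _ (compact_setX cX cY).
- by exists (p0, q0).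
- exact: continuous_subspaceT.
rewrite inE => -[/= Xp Yq] minpq.
have pq : 0 < f (p, q).
  rewrite /f normr_gt0 subr_eq0 /=; apply/eqP => pq.
  have : (X `&` Y) p by split=> //; rewrite pq.
  by rewrite XY0.
near=> eps => p' q' Xp' Yq'.
have : f (p, q) <= f (p', q') by apply: minpq; rewrite inE.
apply: le_trans; near: eps; exact: nbhs_right_le.
Unshelve. all: by end_near. Qed.

Lemma uniformly_continuous_segment g (delta : R) :
  {within `[0, 1], continuous g} -> 0 < delta ->
  exists2 eps, 0 < eps & forall x y, x \in `[0, 1] -> y \in `[0, 1] ->
    `|x - y| < eps -> `|g x - g y| < delta.
Proof.
move=> /subspace_continuousP cg d0.
have /compact_near_coveringP cover01 := @segment_compact R 0 1.
pose P (i x : R) := x \in `[0, 1] ->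
  forall y, y \in `[0, 1] -> `|x - y| < i -> `|g x - g y| < delta.
have H : \forall i \near (0 : R)^'+, `[0, 1] `<=` P i.
  apply: cover01 => x x01.
  have d2 : 0 < delta / 2 by rewrite divr_gt0.
  have := cg x x01 => /cvgrPdist_lt/(_ _ d2).
  rewrite near_withinE => /nbhs_ballP[e /= e0 He].
  have e2 : 0 < e / 2 by rewrite divr_gt0.
  (* With half the radius for each displacement, both values stay within [delta / 2] of [g x]. *)
  exists (ball x (e / 2), [set i | i < e / 2]).
    split=> /=; first exact: nbhsx_ballx.
    exact: nbhs_right_lt.
  case=> x' i [/= xx' ie] x'01 y y01 x'y.
  have h1 : `|g x - g x'| < delta / 2.
    apply: He; last by rewrite inE in x'01.
    by move: xx'; rewrite /ball /=; lra.
  have h2 : `|g x - g y| < delta / 2.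
    apply: He; last by rewrite inE in y01.
    rewrite /ball /= in xx' *; have := ler_distD x' x y; lra.
  have := ler_distD (g x) (g x') (g y); rewrite (distrC (g x') (g x)); lra.
have [eps [/= eps0 Heps]] := filter_ex (filterI (nbhs_right_gt (0 : R)) H).
exists eps => // x y x01 y01 xy; apply: (Heps x) => //; by rewrite inE in x01.
Qed.

Section Drawing.
Variables (G : sgraph) (pt : G -> R * R) (gam : G -> G -> R -> R * R).
Hypothesis draw : plane_drawing pt gam.

Let pt_inj : injective pt. Proof. by case: draw. Qed.

Lemma arc_continuous u v : adj G u v -> {within `[0, 1], continuous (gam u v)}.
Proof. by case: draw => _ H _ _ /H[]. Qed.

Lemma arc0 u v : adj G u v -> gam u v 0 = pt u.
Proof. by case: draw => _ H _ _ /H[]. Qed.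

Lemma arc1 u v : adj G u v -> gam u v 1 = pt v.
Proof. by case: draw => _ H _ _ /H[]. Qed.

Lemma arc_vertex u v w x : adj G u v -> x \in `[0, 1] -> gam u v x = pt w ->
  w = u \/ w = v.
Proof.
move=> uv; rewrite in_itv /= => /andP[x0 x1] xw.
have [x0'|x0'] := eqVneq x 0; first by left; apply: pt_inj; rewrite -xw x0' arc0.
have [x1'|x1'] := eqVneq x 1; first by right; apply: pt_inj; rewrite -xw x1' arc1.
have [_ _ H _] := draw; case: (H u v w x uv) => //.
by rewrite in_itv /= !lt_neqAle x0 x1 x1' eq_sym x0'.
Qed.

Lemma arc_compact u v : adj G u v -> compact (gam u v @` `[0, 1]).
Proof.
by move=> uv; apply: continuous_compact; [exact: arc_continuous|exact: segment_compact].
Qed.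

Lemma vertex_arc_margin : \forall eps \near 0^'+, forall u v w x, adj G u v ->
  w != u -> w != v -> x \in `[0, 1] -> eps <= `|gam u v x - pt w|.
Proof.
apply: filter_forall => u; apply: filter_forall => v; apply: filter_forall => w.
have [uv|nuv] := boolP (adj G u v); last by apply: nearW => eps x.
have [->|wu] := eqVneq w u; first by apply: nearW => eps.
have [->|wv] := eqVneq w v; first by apply: nearW => eps.
have := compact_separation (arc_compact uv) (@compact_set1 _ (pt w)).
case=> [|eps eps0 H].
  apply/seteqP; split=> // p [[x /= x01 <-] /= xw].
  have := arc_vertex uv _ xw; case; [by rewrite inE|by move/eqP; rewrite (negPf wu)|].
  by move/eqP; rewrite (negPf wv).
exists eps => // e ? ? x _ _ _ x01; apply: H => //; exists x => //.
Qed.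

Lemma vertex_margin : \forall eps \near 0^'+, forall u v, u != v ->
  eps <= `|pt u - pt v|.
Proof.
apply: filter_forall => u; apply: filter_forall => v.
have [->|uv] := eqVneq u v; first by apply: nearW => eps.
near=> eps => _; near: eps; apply: nbhs_right_le.
by rewrite normr_gt0 subr_eq0 (inj_eq pt_inj).
Unshelve. all: by end_near. Qed.

Definition off_vertices (r : R) (p : R * R) : Prop := forall w, r <= `|p - pt w|.

(** Arcs with a common end are at distance 0; removing the balls of radius [r] around the vertices
    leaves disjoint compact sets. *)
Lemma arc_margin (r : R) : 0 < r -> \forall eps \near 0^'+, forall u v u' v' x x',
  adj G u v -> adj G u' v' -> (u', v') != (u, v) -> (u', v') != (v, u) ->
  x \in `[0, 1] -> x' \in `[0, 1] ->
  off_vertices r (gam u v x) -> off_vertices r (gam u' v' x') ->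
  eps <= `|gam u v x - gam u' v' x'|.
Proof.
move=> r0; apply: filter_forall => u; apply: filter_forall => v.
apply: filter_forall => u'; apply: filter_forall => v'.
have [uv|nuv] := boolP (adj G u v); last by apply: nearW => eps x x'.
have [uv'|nuv] := boolP (adj G u' v'); last by apply: nearW => eps x x'.
have [e1|ne1] := eqVneq (u', v') (u, v); first by apply: nearW => eps.
have [e2|ne2] := eqVneq (u', v') (v, u); first by apply: nearW => eps.
have closed_off : closed (off_vertices r).
  have -> : off_vertices r = \bigcap_(w in [set: G]) [set p | r <= `|p - pt w|].
    by apply/seteqP; split=> p H w; [move=> _; exact: H | exact: H].
  apply: closed_bigI => w _.
  pose f (p : R * R) : R := `|p - pt w|.
  change (closed (f @^-1` [set y | r <= y])); apply: preimage_closed; last exact: closed_ge.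
  by move=> p _; apply: cvg_norm; apply: cvgB; [exact: cvg_id|exact: cvg_cst].
have := compact_separation (compact_closedI (arc_compact uv) closed_off)
  (compact_closedI (arc_compact uv') closed_off).
have open01 a b x : adj G a b -> x \in `[0, 1] -> off_vertices r (gam a b x) -> x \in `]0, 1[.
  move=> ab; rewrite !in_itv /= => /andP[x0 x1] off; rewrite !lt_neqAle x0 x1 !andbT.
  apply/andP; split; apply/eqP => E.
    by have := off a; rewrite -E arc0 // subrr normr0 leNgt r0.
  by have := off b; rewrite E arc1 // subrr normr0 leNgt r0.
case=> [|eps eps0 H].
  apply/seteqP; split=> // p [[[x /= x01 xp] offp] [[x' /= x01' xp'] _]].
  have [_ _ _ /(_ u v u' v' x x' uv uv' ne1 ne2)] := draw; apply.
  - by apply: open01 uv _ _; rewrite ?inE ?xp.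
  - by apply: open01 uv' _ _; rewrite ?inE ?xp'.
  - by rewrite xp xp'.
exists eps => // e ? ? x x' _ _ _ _ x01 x01' off off'; apply: H => //.
Qed.

End Drawing.
End Separation.

Section Sampling.
Local Open Scope classical_set_scope.
Local Open Scope ring_scope.
Variable R : realType.

Definition lattice_floor (p : R * R) : lpoint := (Num.floor p.1, Num.floor p.2).

(** The tolerance 2 allows 1 for rounding and 1 for the variation between consecutive samples. *)
Definition lattice_close (a : lpoint) (p : R * R) : Prop :=
  `|a.1%:~R - p.1| < 2 /\ `|a.2%:~R - p.2| < 2.

Lemma between_floors_close (x y : R) (a : int) : `|x - y| < 1 ->
  Num.min (Num.floor x) (Num.floor y) <= a -> a <= Num.max (Num.floor x) (Num.floor y) ->
  `|a%:~R - x| < 2.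
Proof.
move=> xy la ua.
have fx := floor_itv x; have fy := floor_itv y.
have : ((Num.floor x <= a) && (a <= Num.floor y)) || ((Num.floor y <= a) && (a <= Num.floor x)).
  by move: la ua; lia.
rewrite !intrD !ltr_norml in fx fy xy *.
by case/orP=> /andP[]; rewrite -!(ler_int R) => h1 h2; lra.
Qed.

(** Samples at the multiples of [1 / n] with [1 / n < eps] are rounded and joined by monotone walks,
    which stay in the bounding box of two rounded samples. *)
Lemma lattice_walk (g : R -> R * R) (eps : R) : 0 < eps ->
  (forall x y, x \in `[0, 1] -> y \in `[0, 1] -> `|x - y| < eps -> `|g x - g y| < 1) ->
  exists A, [/\ path ladj (lattice_floor (g 0)) A,
    last (lattice_floor (g 0)) A = lattice_floor (g 1) &
    forall a, a \in lattice_floor (g 0) :: A ->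
      exists x, x \in `[0, 1] /\ lattice_close a (g x)].
Proof.
move=> eps0 ug.
pose n := (Num.truncn (eps^-1)).+1.
have n0 : 0 < n%:R :> R by rewrite ltr0n.
have neps : n%:R^-1 < eps.
  rewrite -[eps]invrK ltf_pV2 ?posrE ?invr_gt0 //.
  exact: truncnS_gt.
pose x (i : nat) : R := i%:R / n%:R.
have x01 i : (i <= n)%N -> x i \in `[0, 1].
  move=> le_in; rewrite in_itv /= divr_ge0 ?ler0n //=.
  by rewrite ler_pdivrMr // mul1r ler_nat.
suff H i : (i <= n)%N -> exists A, [/\ path ladj (lattice_floor (g 0)) A,
    last (lattice_floor (g 0)) A = lattice_floor (g (x i)) &
    forall a, a \in lattice_floor (g 0) :: A ->
      exists x, x \in `[0, 1] /\ lattice_close a (g x)].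
  by have := H n (leqnn n); rewrite /x divff // gt_eqF.
elim: i => [_|i IHi lt_in].
  exists [::]; rewrite /x mul0r; split=> // a; rewrite inE => /eqP->.
  exists 0; split; first by rewrite in_itv /= lexx ler01.
  rewrite /lattice_close /=; have f1 := floor_itv (g 0).1; have f2 := floor_itv (g 0).2.
  by rewrite !intrD !ltr_norml in f1 f2 *; split; lra.
have [A [pA lA cA]] := IHi (ltnW lt_in).
have [w [pw lw box]] := monotone_walk (lattice_floor (g (x i))) (lattice_floor (g (x i.+1))).
have close1 : `|g (x i) - g (x i.+1)| < 1.
  apply: ug; [exact: x01 (ltnW lt_in)|exact: x01|].
  rewrite /x -mulrBl -addn1 natrD opprD addrA subrr add0r mulN1r normrN.
  by rewrite ger0_norm // invr_ge0 ler0n.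
exists (A ++ w); split.
- by rewrite cat_path pA lA.
- by rewrite last_cat lA.
move=> a; rewrite -cat_cons mem_cat => /orP[/cA//|/box[b1 b2 b3 b4]].
exists (x i); split; first exact: x01 (ltnW lt_in).
move: close1; rewrite prod_normE /= gt_max => /andP[c1 c2].
by split; [exact: between_floors_close c1 b1 b2 | exact: between_floors_close c2 b3 b4].
Qed.

Lemma lattice_floor_close (p : R * R) :
  `|(lattice_floor p).1%:~R - p.1| < 1 /\ `|(lattice_floor p).2%:~R - p.2| < 1.
Proof.
have := floor_itv p.1; have := floor_itv p.2.
by rewrite /= !intrD !ltr_norml => f2 f1; split; lra.
Qed.

Lemma in_squareR (K : int) (c a : lpoint) : in_square K c a <->
  `|a.1%:~R - c.1%:~R| <= K%:~R :> R /\ `|a.2%:~R - c.2%:~R| <= K%:~R :> R.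
Proof.
rewrite /in_square -!intrB -!intr_norm !ler_int; split; first by case/andP.
by case=> -> ->.
Qed.

Lemma norm_pair_lt (p : R * R) (c : R) : `|p| < c <-> `|p.1| < c /\ `|p.2| < c.
Proof. by rewrite prod_normE gt_max; split=> [/andP//|[-> ->]]. Qed.

Section PlanarDual.
Variables (G : sgraph) (pt : G -> R * R) (gam : G -> G -> R -> R * R).
Hypothesis draw : plane_drawing pt gam.
Variables (E : finType) (s t : E -> G).
Hypothesis adj_edge : forall e, adj G (s e) (t e).
Hypothesis edge_inj : forall e e',
  s e = s e' /\ t e = t e' \/ s e = t e' /\ t e = s e' -> e = e'.

Lemma drawing_dual (v0 : G) : exists (F : finType) (f1 f2 : E -> F),
  (forall f, even_set s t (face_bdry f1 f2 [set f]%SET)) /\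
  (forall z, even_set s t z -> exists phi, z = face_bdry f1 f2 phi).
Proof.
have [m [m0 [arcm vtxm]]] := filter_ex (filterI (nbhs_right_gt (0 : R))
  (filterI (vertex_arc_margin draw) (vertex_margin draw))).
rewrite /= in m0.
(* After scaling by [c = N / r], the margin [m] becomes [8 * N] and [r] becomes [N]. Squares of
   half-side [2 * N] then fit with room for rounding. *)
pose r := m / 8.
have r0 : 0 < r by rewrite divr_gt0.
have [eta [/= eta0 arcs_apart]] :=
  filter_ex (filterI (nbhs_right_gt (0 : R)) (arc_margin draw r0)).
(* [N > 4 * r / eta] makes [c * eta > 4]; [N >= 4] absorbs the rounding errors, such as
   [N + 3 <= 2 * N] below. *)
pose N := (Num.truncn (4 * r / eta)).+4.
have N4 : 4 <= N%:R :> R by rewrite ler_nat.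
have Neta : 4 * r < N%:R * eta.
  rewrite -ltr_pdivrMr //; apply: lt_le_trans (truncnS_gt _) _.
  by rewrite ler_nat; exact: leqW (leqW (leqW (leqnn _))).
pose c := N%:R / r.
have c0 : 0 < c by rewrite divr_gt0 //; lra.
have cm : c * m = 8 * N%:R by rewrite /c /r; field; lra.
have cr : c * r = N%:R by rewrite /c; field; lra.
have ceta : 4 < c * eta by rewrite /c mulrAC ltr_pdivlMr.
have normc p : `|c *: p| = c * `|p| :> R by rewrite normrZ gtr0_norm.
have walks e : exists A, [/\ path ladj (lattice_floor (c *: pt (s e))) A,
    last (lattice_floor (c *: pt (s e))) A = lattice_floor (c *: pt (t e)) &
    forall a, a \in lattice_floor (c *: pt (s e)) :: A ->
      exists x, x \in `[0, 1] /\ lattice_close a (c *: gam (s e) (t e) x)].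
  have cV : 0 < c^-1 by rewrite invr_gt0.
  have [eps eps0 H] :=
    uniformly_continuous_segment (arc_continuous draw (adj_edge e)) cV.
  have := @lattice_walk (fun x => c *: gam (s e) (t e) x) eps eps0.
  rewrite (arc0 draw) // (arc1 draw) //; apply=> x y x01 y01 /(H x y x01 y01).
  by rewrite -scalerBr normc -(ltr_pM2l c0) divff // gt_eqF.
have [A AP] := fin_all_exists walks.
pose K : int := (N + N)%:Z.
have KR : K%:~R = 2 * N%:R :> R by rewrite /K -pmulrn natrD; lra.
apply: (@squares_dual _ _ s t (fun v => lattice_floor (c *: pt v)) K A) => //.
- move=> e; apply: contraTneq (adj_edge e) => ->; by rewrite adj_irr.
- by move=> e; have [] := AP e.
- by move=> e; have [] := AP e.
- move=> u v uv; apply/negP => /in_squareR.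
  rewrite !intrD KR /= => -[h1 h2].
  have := vtxm u v uv; rewrite -(ler_pM2l c0) cm -normc scalerBr leNgt => /negP; apply.
  have [u1 u2] := lattice_floor_close (c *: pt u).
  have [v1 v2] := lattice_floor_close (c *: pt v).
  apply/norm_pair_lt; move: h1 h2 u1 u2 v1 v2 => /=.
  by rewrite !ltr_norml !ler_norml => *; split; lra.
- move=> e w a ws wt /(let: And3 _ _ H := AP e in H a) [x [x01 [a1 a2]]].
  apply/negP => /in_squareR; rewrite KR /= => -[h1 h2].
  have := arcm (s e) (t e) w x (adj_edge e) ws wt x01.
  rewrite -(ler_pM2l c0) cm -normc scalerBr leNgt => /negP; apply.
  have [w1 w2] := lattice_floor_close (c *: pt w).
  apply/norm_pair_lt; move: h1 h2 a1 a2 w1 w2 => /=.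
  by rewrite !ltr_norml !ler_norml => *; split; lra.
- move=> e e' a /(let: And3 _ _ H := AP e in H a) [x [x01 ax]].
  move=> /(let: And3 _ _ H := AP e' in H a) [x' [x01' ax']] off.
  have off_close u v y : lattice_close a (c *: gam u v y) -> off_vertices pt r (gam u v y).
    case=> a1 a2 w; rewrite leNgt; apply: contra (off w).
    rewrite -(ltr_pM2l c0) cr -normc scalerBr => /norm_pair_lt[/= g1 g2].
    apply/in_squareR; rewrite KR.
    have [w1 w2] := lattice_floor_close (c *: pt w).
    move: a1 a2 g1 g2 w1 w2 => /=.
    by rewrite !ltr_norml !ler_norml => *; split; lra.
  (* A common lattice point is within 2 of both scaled arcs, putting them within 4 of each other,
     less than [c * eta]. *)
  apply/eqP; apply: contraT => ee'.
  have := @arcs_apart _ _ _ _ x x' (adj_edge e) (adj_edge e').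
  have -> : (s e', t e') != (s e, t e).
    by apply: contraNneq ee' => -[? ?]; apply/eqP/edge_inj; left.
  have -> : (s e', t e') != (t e, s e).
    by apply: contraNneq ee' => -[? ?]; apply/eqP/edge_inj; right.
  move=> /(_ isT isT x01 x01' (off_close _ _ _ ax) (off_close _ _ _ ax')).
  rewrite -(ler_pM2l c0) -normc scalerBr leNgt => /negP; case.
  apply: lt_trans ceta; apply/norm_pair_lt; case: ax ax' => a1 a2 [b1 b2].
  by move: a1 a2 b1 b2; rewrite /= !ltr_norml => *; split; lra.
Qed.

End PlanarDual.
End Sampling.

From mathcomp Require Import fintype finset.

(** * Sparsity of planar graphs of girth at least 8 *)

Section Sparsity.
Variables (R : realType) (G : sgraph).
Hypothesis planarG : planar R G.
Hypothesis girthG : (8%:R%:E <= girth R G)%E.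

Lemma girth_ge8 (c : seq G) : ucycle (adj G) c -> 3 <= size c -> 8 <= size c.
Proof.
move=> cyc c3; have le : (girth R G <= ((size c)%:R)%:E)%E.
  by apply: ereal_inf_lbound; exists c.
by have := le_trans girthG le; rewrite lee_fin ler_nat.
Qed.

(** The ranks orient each edge of the induced subgraph once. *)
Definition edge_pred (A : {set G}) : pred (G * G) := [pred d |
  [&& d.1 \in A, d.2 \in A, adj G d.1 d.2 & enum_rank d.1 < enum_rank d.2]].

Lemma card_darts (A : {set G}) :
  \sum_(v in A) #|[set w in A | adj G v w]| <=
  2 * #|edge_pred A|.
Proof.
pose P (d : G * G) := [&& d.1 \in A, d.2 \in A & adj G d.1 d.2].
pose lt (d : G * G) := enum_rank d.1 < enum_rank d.2.
have -> : \sum_(v in A) #|[set w in A | adj G v w]| = #|[set d | P d]|.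
  under eq_bigr do rewrite -sum1_card.
  rewrite pair_big_dep /= -sum1_card; apply: eq_bigl => -[v w].
  by rewrite !inE /P.
have -> : #|edge_pred A|
    = #|[set d | P d & lt d]|.
  by apply: eq_card => d; rewrite !inE /P /lt /= -!andbA.
have -> : [set d | P d] = [set d | P d & lt d] :|: [set d | P d & ~~ lt d].
  by apply/setP => d; rewrite !inE -andb_orr orbN andbT.
apply: leq_trans (leq_card_setU _ _) _; rewrite mul2n -addnn leq_add2l.
pose swap (d : G * G) := (d.2, d.1).
have swapK : cancel swap swap by case.
rewrite -(card_imset _ (can_inj swapK)).
apply/subset_leq_card/subsetP => _ /imsetP[[u v] + ->].
rewrite !inE /P /lt /= => /andP[/and3P[-> -> uv]]; rewrite adj_sym uv /= -leqNgt => le_vu.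
rewrite ltn_neqAle le_vu andbT; apply: contraTneq uv => /ord_inj/enum_rank_inj->.
by rewrite adj_irr.
Qed.

Lemma planar_sparse (A : {set G}) : A != set0 ->
  3 * \sum_(v in A) #|[set w in A | adj G v w]| < 8 * #|A|.
Proof.
case/set0Pn=> v0 Av0; have [pt [gam draw]] := planarG.
pose P := edge_pred A.
pose E : finType := {d | P d}.
pose s (e : E) := (val e).1; pose t (e : E) := (val e).2.
have adj_edge e : adj G (s e) (t e) by case/and4P: (valP e).
have edge_inj e e' :
    s e = s e' /\ t e = t e' \/ s e = t e' /\ t e = s e' -> e = e'.
  move: (valP e) (valP e') => /and4P[_ _ _ lt1] /and4P[_ _ _ lt2] H.
  apply: val_inj; rewrite (surjective_pairing (val e)) (surjective_pairing (val e')).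
  case: H => -[]; rewrite /s /t => e1 e2; first by rewrite e1 e2.
  by move: lt1; rewrite e1 e2 ltnNge (ltnW lt2).
have [F [f1 [f2 [face_even face_cover]]]] := drawing_dual draw adj_edge edge_inj v0.
have sA e : s e \in A by case/and4P: (valP e).
have tA e : t e \in A by case/and4P: (valP e).
(* This gives [6 * #|E| + 8 <= 8 * #|A|], while the degree sum is at most [2 * #|E|]. *)
have := euler_bound (g := 8) sA tA Av0 face_even face_cover
  (fun z => even_set_long (@adj_sym G) (@adj_irr G) adj_edge edge_inj girth_ge8).
have cE : #|E| = #|P| by rewrite card_sig; apply: eq_card.
by have := card_darts A; rewrite -[X in _ <= 2 * X]/#|P| -cE; lia.
Qed.

End Sparsity.

(** * Minimal counterexample and conclusion *)

Lemma sparse_list_colorable (V : finType) (adj : rel V) (k : nat) :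
  symmetric adj -> irreflexive adj -> 4 <= k ->
  (forall A v, #|nbrs adj A v| <= k) ->
  (forall c, ucycle adj c -> 3 <= size c -> 8 <= size c) ->
  (forall A : {set V}, A != set0 -> 3 * \sum_(v in A) #|nbrs adj A v| < 8 * #|A|) ->
  forall (C : finType) (L : V -> {set C}), (forall v, k + 3 <= #|L v|) ->
  forall A, list_colorable adj L A.
Proof.
move=> adjC adj0 k4 degk girth8 sparse C L Lk A.
have [n] := ubnP #|A|; elim: n A => // n IHn A lt_An.
have [->|A0] := eqVneq A set0.
  have /fin_all_exists[phi phiL] : forall v, exists c, c \in L v.
    move=> v; have /card_gt0P[c cL] : 0 < #|L v| by apply: leq_trans (Lk v); rewrite addn3.
    by exists c.
  by exists phi; split=> // u v; rewrite inE.
have [//|nA] := pselect (list_colorable adj L A); exfalso.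
have := sparse A A0; rewrite ltnNge => /negP; apply.
(* A reducible [S] would transfer a colouring of the smaller set, available by induction, to [A]. *)
apply: (discharging adjC adj0 k4 (degk A) girth8) => S S0 /allP SA redS.
apply: nA; apply: (redS C L Lk); apply: IHn.
rewrite ltnS in lt_An; apply: leq_trans lt_An; apply: proper_card.
case: S S0 SA {redS} => // x S _ SA; apply/properP; split; first exact: subsetDl.
by exists x; [apply: SA; rewrite mem_head | rewrite !inE eqxx].
Qed.

Theorem corollary5 (R : realType) (G : sgraph) :
  planar R G -> (8%:R%:E <= girth R G)%E -> (4 <= max_degree G)%N ->
  (chi2l G <= max_degree G + 3)%N.
Proof.
move=> planarG girthG D4; rewrite /chi2l; case: ex_minnP => k _; apply; apply/asboolP.
move=> C L Lk.
have degk A v : #|nbrs (adj G) A v| <= max_degree G.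
  apply: leq_trans (leq_bigmax v); apply/subset_leq_card/subsetP => w.
  by rewrite mem_nbrs => /andP[].
have [phi [phiL phiP]] := sparse_list_colorable (@adj_sym G) (@adj_irr G) D4 degk
  (girth_ge8 girthG) (planar_sparse planarG girthG) Lk [set: G]%SET.
exists phi; split=> [u v uv [p [up pv sz]]|v]; last by apply: phiL; rewrite inE.
(* On the full vertex set, a walk of length 1 or 2 between distinct vertices is a conflict. *)
apply: phiP; rewrite ?inE //; rewrite /conflict uv /=.
case: p up pv sz => [|w [|x [|? ?]]] //=; first by move=> _ E; rewrite E eqxx in uv.
  by rewrite andbT => uw <-; rewrite uw.
case/and3P=> uw wx _ <- _; apply/orP; right; apply/exists_inP; exists w; rewrite ?inE //.
by rewrite uw wx.
Qed.
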